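(* Every connected graph $G$ contains a principal vertex or an induced $P_5$. Moreover, there is an $O(|V(G)|+|E(G)|)$-time algorithm that, given a connected graph $G$, either finds a principal vertex of $G$ or finds an induced $P_5$ in $G$ (thereby detecting that $G$ is not $P_5$-free).
   Context: Graphs are finite, simple and undirected. $P_5$ is the path on 5 vertices. The eccentricity of a vertex $v$ in a connected graph is the maximum distance from $v$ to any other vertex; a principal vertex is a vertex of eccentricity at most 2. *)

(* Defs.v *)
From mathcomp Require Import all_boot.

Set Implicit Arguments.
Unset Strict Implicit.
Unset Printing Implicit Defensive.

(** * Graphs *)

Record sgraph := SGraph {
  vertex :> finType;
  adj : rel vertex;
  adj_sym : symmetric adj;
  adj_irrefl : irreflexive adj }.

Definition edges (G : sgraph) : {set {set G}} :=
  [set A : {set G} | [exists x : G, exists y : G, adj x y && (A == [set x; y])]].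

(* The null graph is not connected. *)
Definition connected (G : sgraph) : Prop :=
  0 < #|G| /\ forall x y : G, connect (@adj G) x y.

Definition walk_of_length (G : sgraph) (x y : G) (k : nat) : bool :=
  [exists p : k.-tuple G, path (@adj G) x p && (last x p == y)].

(* The least length of a walk from x to y. A shortest walk has fewer than #|G|
   edges, so bounding the search loses nothing; the value is #|G| when x and y
   lie in different components. *)
Definition dist (G : sgraph) (x y : G) : nat :=
  find (walk_of_length x y) (iota 0 #|G|).

Definition eccentricity (G : sgraph) (v : G) : nat := \max_(w : G) dist v w.

Definition principal (G : sgraph) (v : G) : Prop := eccentricity v <= 2.

Definition path_adj (n : nat) : rel 'I_n :=
  fun i j => (i.+1 == j :> nat) || (j.+1 == i :> nat).

Lemma path_adj_sym n : symmetric (@path_adj n).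
Proof. by move=> i j; rewrite /path_adj orbC. Qed.

Lemma path_adj_irrefl n : irreflexive (@path_adj n).
Proof. by move=> i; rewrite /path_adj orbb; apply/negbTE; rewrite neq_ltn ltnSn orbT. Qed.

Definition path_graph (n : nat) : sgraph :=
  SGraph (@path_adj_sym n) (@path_adj_irrefl n).

Definition induced_embedding (H G : sgraph) (f : H -> G) : Prop :=
  injective f /\ forall x y : H, adj (f x) (f y) = adj x y.

Definition contains_induced (H G : sgraph) : Prop :=
  exists f : H -> G, induced_embedding f.

(** * Random access machine

   Structured programs over an unbounded bank of registers and a random access
   memory, with unit cost for each instruction and each evaluation of a test.
   A program text names finitely many registers; computed addresses are
   possible only in the memory. *)

Inductive test :=
| TestLt of nat & nat
| TestEq of nat & nat.

Inductive prog :=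
| Skip
| Const of nat & nat
| Add of nat & nat & nat
| Sub of nat & nat & nat
| Read of nat & nat
| Write of nat & nat
| Seq of prog & prog
| If of test & prog & prog
| While of test & prog.

Record state := State { reg : nat -> nat; ram : nat -> nat }.

Definition upd (f : nat -> nat) (a v : nat) : nat -> nat :=
  fun x => if x == a then v else f x.

Definition set_reg (s : state) (a v : nat) : state :=
  State (upd (reg s) a v) (ram s).

Definition set_mem (s : state) (a v : nat) : state :=
  State (reg s) (upd (ram s) a v).

Definition eval_test (b : test) (s : state) : bool :=
  match b with
  | TestLt i j => reg s i < reg s j
  | TestEq i j => reg s i == reg s j
  end.

(* [exec W p s t s']: started in s, p halts in s' after t steps. Words hold the
   numbers 0..W; an instruction whose result exceeds W has no transition, so
   [exec] also asserts that the run fits in words of this size. *)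
Inductive exec (W : nat) : prog -> state -> nat -> state -> Prop :=
| ExecSkip s : exec W Skip s 1 s
| ExecConst a k s :
    k <= W -> exec W (Const a k) s 1 (set_reg s a k)
| ExecAdd a b c s :
    reg s b + reg s c <= W ->
    exec W (Add a b c) s 1 (set_reg s a (reg s b + reg s c))
| ExecSub a b c s :
    reg s b - reg s c <= W ->
    exec W (Sub a b c) s 1 (set_reg s a (reg s b - reg s c))
| ExecRead a b s :
    ram s (reg s b) <= W ->
    exec W (Read a b) s 1 (set_reg s a (ram s (reg s b)))
| ExecWrite a b s :
    exec W (Write a b) s 1 (set_mem s (reg s a) (reg s b))
| ExecSeq p q s1 s2 s3 t1 t2 :
    exec W p s1 t1 s2 -> exec W q s2 t2 s3 ->
    exec W (Seq p q) s1 (t1 + t2) s3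
| ExecIfTrue b p q s s' t :
    eval_test b s -> exec W p s t s' -> exec W (If b p q) s t.+1 s'
| ExecIfFalse b p q s s' t :
    ~~ eval_test b s -> exec W q s t s' -> exec W (If b p q) s t.+1 s'
| ExecWhileFalse b p s :
    ~~ eval_test b s -> exec W (While b p) s 1 s
| ExecWhileTrue b p s1 s2 s3 t1 t2 :
    eval_test b s1 -> exec W p s1 t1 s2 -> exec W (While b p) s2 t2 s3 ->
    exec W (While b p) s1 (t1 + t2).+1 s3.

Lemma exec_det W p s t1 s1 t2 s2 :
  exec W p s t1 s1 -> exec W p s t2 s2 -> t1 = t2 /\ s1 = s2.
Proof.
move=> H; elim: H t2 s2 => {p s t1 s1} /=; intros;
  match goal with H : exec _ _ _ _ _ |- _ => inversion H; subst end => //;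
  repeat match goal with
  | H : is_true (~~ ?b), H' : is_true ?b |- _ => by rewrite H' in H
  | IH : forall t s, exec _ ?p ?s0 t s -> _, H : exec _ ?p ?s0 _ _ |- _ =>
      by have [? ?] := IH _ _ H; subst
  | IH : forall t s, exec _ ?p ?s0 t s -> _, H : exec _ ?p ?s0 _ _ |- _ =>
      have [? ?] := IH _ _ H; subst; clear IH
  end.
Qed.

(** * Input and output *)

Definition labelling (G : sgraph) (lab : G -> nat) : Prop :=
  injective lab /\ forall v, lab v < #|G|.

(* The i-th list holds the labels of the neighbours of the vertex labelled i,
   in any order and without repetition. *)
Definition adjacency_lists (G : sgraph) (lab : G -> nat)
    (L : seq (seq nat)) : Prop :=
  size L = #|G| /\
  forall v, perm_eq (nth [::] L (lab v)) [seq lab w | w <- enum G & adj v w].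

(* With n lists: cell 0 holds n, cell 1 + i (0 <= i < n) holds the address of
   the first entry of the i-th list, cell 1 + n holds the first address after
   the input, and the lists follow one another from address n + 2. *)
Definition encode (L : seq (seq nat)) : seq nat :=
  size L ::
  [seq size L + 2 + sumn (take i (shape L)) | i <- iota 0 (size L).+1]
  ++ flatten L.

Definition initial_state (input : seq nat) : state :=
  State (fun=> 0) (nth 0 input).

Definition reports_principal (G : sgraph) (lab : G -> nat) (s : state) : Prop :=
  reg s 0 = 0 /\ exists v : G, reg s 1 = lab v /\ principal v.

Definition reports_induced_P5 (G : sgraph) (lab : G -> nat) (s : state) : Prop :=
  reg s 0 = 1 /\
  exists f : path_graph 5 -> G, induced_embedding f /\
    forall i : 'I_5, reg s i.+1 = lab (f i).

(* Main.v *)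
Require Import Defs.
From mathcomp Require Import all_boot zify.

(** Let v be any vertex and L0, L1, L2, ... its distance layers. If L3 is empty
   then v is principal, and if L4 is not then a shortest path to L4 is an
   induced P5. Otherwise let y in L2 have the most neighbours in L3 and let u
   in L1, adjacent to y, have the most neighbours in L2. If u is not principal,
   some w is at distance 3 from u, and w lies in L2 or L3.

   If w is in L2, take a neighbour u' of w in L1. The choice of u yields z in
   L2 adjacent to u but not to u', and z u v u' w is an induced P5.

   If w is in L3, take a neighbour a of w in L2 and a neighbour u2 of a in L1.
   The choice of y yields c in L3 adjacent to y but not to a. According to
   which of the pairs cw, ya, u2y, u u2 is the first to be an edge, one of
   v u y c w, v u y a w, c y u2 a w, c y u u2 a, or finally y u v u2 a is an
   induced P5.

   Everything is computed by a bounded number of sweeps over the adjacency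
   lists. The algorithm never fails, so it also proves the existence claim. *)

Set Implicit Arguments.
Unset Strict Implicit.
Unset Printing Implicit Defensive.

(** * Program logic *)

(** By [exec_det] a program has at most one outcome from a given state, so the existence of one good
    run is total correctness with a time bound. *)
Definition ok W p s T (Q : state -> Prop) :=
  exists t s', exec W p s t s' /\ t <= T /\ Q s'.

Definition bounded W s := (forall r, reg s r <= W) /\ (forall a, ram s a <= W).

Fixpoint assigned (r : nat) (p : prog) : bool :=
  match p with
  | Skip | Write _ _ => false
  | Const a _ | Add a _ _ | Defs.Sub a _ _ | Read a _ => r == a
  | Seq p q | If _ p q => assigned r p || assigned r q
  | While _ p => assigned r p
  end.

Fixpoint writes (p : prog) : bool :=
  match p with
  | Write _ _ => true
  | Seq p q | If _ p q => writes p || writes q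
  | While _ p => writes p
  | _ => false
  end.

(** Meant for loop-free code: the value at [While] is a filler, as [wp] is [False] there. *)
Fixpoint cost (p : prog) : nat :=
  match p with
  | Seq p q => cost p + cost q
  | If _ p q => (maxn (cost p) (cost q)).+1
  | _ => 1
  end.

(* Words are assumed to hold at least the numbers up to 6. Reading and
   subtracting are safe in a bounded state, so only additions have to be
   checked for overflow. *)
Fixpoint wp W (p : prog) (Q : state -> Prop) (s : state) : Prop :=
  match p with
  | Skip => Q s
  | Const a k => k <= 6 /\ Q (set_reg s a k)
  | Add a b c =>
      reg s b + reg s c <= W /\ Q (set_reg s a (reg s b + reg s c))
  | Defs.Sub a b c => Q (set_reg s a (reg s b - reg s c))
  | Read a b => Q (set_reg s a (ram s (reg s b)))
  | Write a b => Q (set_mem s (reg s a) (reg s b))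
  | Seq p q => wp W p (wp W q Q) s
  | If b p q =>
      (eval_test b s -> wp W p Q s) /\ (~~ eval_test b s -> wp W q Q s)
  | While _ _ => False
  end.

Lemma upd_bounded W f a v :
  v <= W -> (forall x, f x <= W) -> forall x, upd f a v x <= W.
Proof. by move=> hv hf x; rewrite /upd; case: ifP. Qed.

Lemma exec_bounded W p s t s' : exec W p s t s' -> bounded W s -> bounded W s'.
Proof.
by elim=> {p s t s'} // *;
  repeat match goal with
  | H : bounded _ _ |- _ => move: (H); clear H
  | H : bounded _ _ -> bounded _ _ |- _ => move: (H); clear H
  end; rewrite /bounded /=; intuition; apply: upd_bounded; auto.
Qed.

Lemma exec_reg W p s t s' r :
  exec W p s t s' -> ~~ assigned r p -> reg s' r = reg s r.
Proof.
elim=> {p s t s'} //= *;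
  repeat match goal with
  | H : is_true (~~ (_ || _)) |- _ => move/norP: H => [? ?]
  | H : is_true (~~ (_ == _)) |- _ => by rewrite /upd (negbTE H)
  | H : is_true (~~ ?b), H' : is_true (~~ ?b) -> _ = _ |- _ => specialize (H' H)
  end; congruence.
Qed.

Lemma exec_ram W p s t s' : exec W p s t s' -> ~~ writes p -> ram s' = ram s.
Proof.
elim=> {p s t s'} //= *;
  repeat match goal with
  | H : is_true (~~ (_ || _)) |- _ => move/norP: H => [? ?]
  | H : is_true (~~ ?b), H' : is_true (~~ ?b) -> _ = _ |- _ => specialize (H' H)
  end; congruence.
Qed.

Lemma ok_weaken W p s T T' (Q Q' : state -> Prop) :
  ok W p s T Q -> T <= T' -> (forall s', Q s' -> Q' s') -> ok W p s T' Q'.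
Proof.
move=> [t [s' [h [ht hQ]]]] hT hQQ; exists t, s'; split=> //.
by split; [apply: leq_trans hT | apply: hQQ].
Qed.

(** Frame rule: a postcondition need only mention what the program changes; the rest is read off its
    text by [assigned] and [writes]. *)
Lemma ok_frame W p s T (Q : state -> Prop) :
  bounded W s -> ok W p s T Q ->
  ok W p s T (fun s' => [/\ Q s', bounded W s',
    forall r, ~~ assigned r p -> reg s' r = reg s r
    & ~~ writes p -> ram s' = ram s]).
Proof.
move=> hs [t [s' [h [ht hQ]]]]; exists t, s'; do 3!split=> //.
- exact: exec_bounded h hs.
- by move=> r; apply: exec_reg h.
- exact: exec_ram h.
Qed.

Lemma ok_seq W p q s T1 T2 (Q : state -> Prop) :
  ok W p s T1 (fun s1 => ok W q s1 T2 Q) -> ok W (Seq p q) s (T1 + T2) Q.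
Proof.
move=> [t1 [s1 [h1 [ht1 [t2 [s2 [h2 [ht2 hQ]]]]]]]].
exists (t1 + t2), s2; split; first exact: ExecSeq h1 h2.
by split=> //; apply: leq_add.
Qed.

Lemma ok_if W b p q s T (Q : state -> Prop) :
  (eval_test b s -> ok W p s T Q) -> (~~ eval_test b s -> ok W q s T Q) ->
  ok W (If b p q) s T.+1 Q.
Proof.
case: (boolP (eval_test b s)) => hb hp hq.
  have [t [s' [h [ht hQ]]]] := hp isT.
  by exists t.+1, s'; split=> //; apply: ExecIfTrue.
have [t [s' [h [ht hQ]]]] := hq isT.
by exists t.+1, s'; split=> //; apply: ExecIfFalse.
Qed.

Lemma wp_ok W p s (Q : state -> Prop) :
  6 <= W -> bounded W s -> wp W p Q s -> ok W p s (cost p) Q.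
Proof.
move=> hW; elim: p s Q => [|a k|a b c|a b c|a b|a b|p IHp q IHq|b p IHp q IHq|b p _]
  s Q hs //=.
- by move=> hQ; exists 1, s; split; first exact: ExecSkip.
- move=> [hk hQ]; exists 1, (set_reg s a k).
  by split=> //; apply: ExecConst; apply: leq_trans hW.
- by move=> [hk hQ]; eexists 1, _; split; first exact: ExecAdd.
- move=> hQ; exists 1, (set_reg s a (reg s b - reg s c)).
  split=> //; apply: ExecSub.
  by apply: leq_trans (leq_subr _ _) _; apply: hs.1.
- by move=> hQ; eexists 1, _; split; first by apply: ExecRead => //; apply: hs.2.
- by move=> hQ; eexists 1, _; split; first exact: ExecWrite.
- move=> /(IHp _ _ hs)/(ok_frame hs) H; apply: ok_seq.
  by apply: ok_weaken H _ _ => // s' [h1 h2 _ _]; apply: IHq.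
- move=> [h1 h2]; apply: ok_if => h.
    by apply: ok_weaken (IHp _ _ hs (h1 h)) _ _ => //; apply: leq_maxl.
  by apply: ok_weaken (IHq _ _ hs (h2 h)) _ _ => //; apply: leq_maxr.
Qed.

(** The number m of rounds is fixed beforehand and the cost may vary with the round, so that each
    row can later be charged its own length. Every round pays one unit for its test, and the final
    unit pays for the failing test. *)
Lemma ok_loop W b p m (I : nat -> state -> Prop) (c : nat -> nat) s :
  (forall k s, k < m -> I k s -> eval_test b s /\ ok W p s (c k) (I k.+1)) ->
  (forall s, I m s -> ~~ eval_test b s) ->
  I 0 s -> ok W (While b p) s (\sum_(0 <= k < m) (c k).+1).+1 (I m).
Proof.
move=> hI hm.
suff H j : forall k s, k + j = m -> I k s ->
    ok W (While b p) s (\sum_(k <= i < m) (c i).+1).+1 (I m).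
  by move=> h0; apply: (H m).
elim: j => [|j IH] k {}s hk hs.
  rewrite addn0 in hk; rewrite hk in hs *.
  exists 1, s; split; last by [].
  by apply: ExecWhileFalse; apply: hm.
have hkm : k < m by lia.
have [hb [t1 [s1 [h1 [ht1 hI1]]]]] := hI _ _ hkm hs.
have [|t2 [s2 [h2 [ht2 hI2]]]] := IH k.+1 s1 _ hI1; first by lia.
exists (t1 + t2).+1, s2; split; first exact: ExecWhileTrue hb h1 h2.
by split=> //; rewrite big_ltn //; lia.
Qed.

(** * Sweeps over the adjacency lists *)

Section Encoding.
Variable L : seq (seq nat).

Definition row x := nth [::] L x.
(** Rows are contiguous, so [row_start x.+1] is also the end of row x. *)
Definition row_start x := size L + 2 + sumn (take x (shape L)).
Definition input_end := row_start (size L).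

Lemma input_endE : input_end = size L + 2 + size (flatten L).
Proof. by rewrite /input_end /row_start take_oversize ?size_map // size_flatten. Qed.

Lemma row_startS x : x < size L -> row_start x.+1 = row_start x + size (row x).
Proof.
move=> hx; rewrite /row_start (take_nth 0) ?size_map // sumn_rcons addnA.
by rewrite (nth_map [::]).
Qed.

Lemma row_start_le x : row_start x <= input_end.
Proof.
rewrite leq_add2l [take (size L) _]take_oversize ?size_map //.
by rewrite -[X in _ <= sumn X](cat_take_drop x) sumn_cat leq_addr.
Qed.

Lemma nth_encode_start x : x <= size L -> nth 0 (encode L) x.+1 = row_start x.
Proof.
have nthS (a : nat) s : nth 0 (a :: s) x.+1 = nth 0 s x by [].
move=> hx; rewrite /encode nthS nth_cat size_map size_iota ltnS hx.
by rewrite (nth_map 0) ?size_iota // nth_iota.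
Qed.

Lemma nth_flatten_row (s : seq (seq nat)) x k :
  x < size s -> k < size (nth [::] s x) ->
  nth 0 (flatten s) (sumn (take x (shape s)) + k) = nth 0 (nth [::] s x) k.
Proof.
elim: s x => [|l s IH] [|x] //= hx hk; rewrite nth_cat.
  by rewrite add0n hk.
by rewrite -addnA ltnNge leq_addr addKn IH.
Qed.

Lemma nth_encode_row x k : x < size L -> k < size (row x) ->
  nth 0 (encode L) (row_start x + k) = nth 0 (row x) k.
Proof.
move=> hx hk; rewrite -(nth_flatten_row hx hk) /encode /row_start.
have sizeS (a : nat) s : size (a :: s) = (size s).+1 by [].
rewrite -cat_cons nth_cat sizeS size_map size_iota.
by rewrite ifF; [congr nth; lia | lia].
Qed.

Lemma row_size_le x : x < size L -> row_start x + size (row x) <= input_end.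
Proof. by move=> hx; rewrite -row_startS // row_start_le. Qed.

Lemma sum_row_size : \sum_(0 <= x < size L) size (row x) = size (flatten L).
Proof.
by rewrite size_flatten sumnE big_map (big_nth [::]).
Qed.

End Encoding.

(* Registers 0 to 5 hold the output. rZero is never assigned and keeps its
   initial value 0, which also serves as the label of the first root. *)
Local Notation rX := 6.
Local Notation rA := 7.
Local Notation rE := 8.
Local Notation rV := 9.
Local Notation rT1 := 10.
Local Notation rT2 := 11.
Local Notation rT3 := 12.
Local Notation rN := 13.
Local Notation rOne := 14.
Local Notation rZero := 15.

(* Runs [body] for every arc (rX, rV), row by row, and [post] after each row.
   The rows are contiguous, so the pointer rA is never reset. *)
Definition sweep body post :=
  Seq (Seq (Const rX 0) (Seq (Add rA rN rOne) (Add rA rA rOne)))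
  (While (TestLt rX rN)
    (Seq (Seq (Add rT1 rX rOne) (Seq (Add rT1 rT1 rOne) (Read rE rT1)))
    (Seq (While (TestLt rA rE)
           (Seq (Read rV rA) (Seq body (Add rA rA rOne))))
    (Seq post (Add rX rX rOne))))).

Definition loop_regs := [:: rX; rA; rE; rV; rT1].

Definition same_but_loop_regs s s' :=
  (forall r, r \notin loop_regs -> reg s' r = reg s r) /\ ram s' = ram s.

Section Sweep.
Variables (L : seq (seq nat)) (W : nat).
Local Notation n := (size L).
Local Notation U := (n + size (flatten L)).
Hypothesis n_gt0 : 0 < n.
(** Addresses must reach past the input and four arrays of n words, a level and a parent array for
    each of two searches: 5n + 2 words plus the flattened lists, which is at most 7U as n is
    positive. *)
Hypothesis hW : 7 * U <= W.

Definition holds_input s := forall a, a < input_end L -> ram s a = nth 0 (encode L) a.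

Definition ready s :=
  [/\ bounded W s, reg s rN = n, reg s rOne = 1, reg s rZero = 0 & holds_input s].

Lemma bounded_set_reg s r v : v <= W -> bounded W s -> bounded W (set_reg s r v).
Proof. by move=> hv [hr hm]; split=> //=; apply: upd_bounded. Qed.

Lemma word_ge6 : 6 <= W. Proof. lia. Qed.

(** [J x k] is to hold once the rows before x and the first k entries of row x are done, so that
    only loop-free code is left to verify. J must ignore the loop registers, which change between
    two calls, and must keep the input intact, since row ends are reread from it. *)
Lemma sweep_ok body post (J : nat -> nat -> state -> Prop) s0 :
  ready s0 ->
  all (fun r => ~~ assigned r body && ~~ assigned r post) [:: rX; rA; rE; rN; rOne] ->
  (forall x k s, J x k s -> holds_input s) ->
  (forall x k s s', same_but_loop_regs s s' -> J x k s -> J x k s') ->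
  let frame s := forall r, ~~ assigned r (sweep body post) -> reg s r = reg s0 r in
  (forall x k s, x < n -> k < size (row L x) -> reg s rX = x ->
     reg s rV = nth 0 (row L x) k -> frame s -> J x k s ->
     wp W body (J x k.+1) s) ->
  (forall x s, x < n -> reg s rX = x -> frame s -> J x (size (row L x)) s ->
     wp W post (J x.+1 0) s) ->
  J 0 0 s0 ->
  ok W (sweep body post) s0 ((10 + cost body + cost post) * U) (J n 0).
Proof.
move=> [bs0 sN sOne sZ inp0] /allP na Jinp Jst frame Hbody Hpost J00.
have hb r : r \in [:: rX; rA; rE; rN; rOne] -> ~~ assigned r body.
  by move=> /na/andP[].
have hp r : r \in [:: rX; rA; rE; rN; rOne] -> ~~ assigned r post.
  by move=> /na/andP[].
have nN : ~~ assigned rN (sweep body post) by rewrite /= (negbTE (hb _ _)) ?(negbTE (hp _ _)).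
have nO : ~~ assigned rOne (sweep body post) by rewrite /= (negbTE (hb _ _)) ?(negbTE (hp _ _)).
have W6 := word_ge6; have eE := input_endE L.
have frame_loop s r v : r \in loop_regs -> frame s -> frame (set_reg s r v).
  move=> hr fs q hq /=; rewrite /upd; case: eqP => [eq|_]; last exact: fs.
  by move: hq hr; rewrite eq !inE /= => /norP[] /negP + /norP[] /negP + /norP[] /negP +; lia.
have same_set s r v : r \in loop_regs -> same_but_loop_regs s (set_reg s r v).
  by move=> hr; split=> //= q; rewrite /upd; case: eqP => [->|//]; rewrite hr.
have frame_sub s s' p : frame s -> (forall r, assigned r p -> assigned r (sweep body post)) ->
    (forall r, ~~ assigned r p -> reg s' r = reg s r) -> frame s'.
  by move=> fs hsub hs' r hr; rewrite hs' ?fs //; apply: contra hr; apply: hsub.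
(* [In] is the invariant of the loop over row x, [Ou] that of the loop over the rows; [In] at the
   end of row x places rA at the start of row x + 1, as [Ou] demands. *)
pose In x k s := [/\ bounded W s, reg s rX = x /\ reg s rA = row_start L x + k,
  reg s rE = row_start L x.+1, frame s & J x k s].
pose Ou x s := [/\ bounded W s, reg s rX = x, reg s rA = row_start L x, frame s & J x 0 s].
have init : wp W (Seq (Const rX 0) (Seq (Add rA rN rOne) (Add rA rA rOne))) (Ou 0) s0.
  rewrite /= /upd /= sN sOne; split=> //; split; first by lia.
  split; first by lia.
  split.
  - by do 3!(apply: bounded_set_reg; first by lia).
  - by [].
  - by rewrite /= /upd /= /row_start take0 addn0 -addnA.
  - by do 3!apply: (frame_loop) => //.
  - by do 3!(apply: (Jst); first by apply: (same_set)).
have inner x s : x < n -> In x 0 s ->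
  ok W (While (TestLt rA rE) (Seq (Read rV rA) (Seq body (Add rA rA rOne)))) s
    (\sum_(0 <= k < size (row L x)) (1 + (cost body + 1)).+1).+1 (In x (size (row L x))).
  move=> hx; apply: ok_loop => [k {}s hk|{}s]; last first.
    by case=> bs [sX sA] sE fs Js; rewrite /= sA sE row_startS // ltnn.
  case=> bs [sX sA] sE fs Js; split.
    by rewrite /= sA sE row_startS // ltn_add2l.
  have hend := row_size_le hx.
  apply: ok_seq; apply: (@wp_ok _ (Read _ _)) => //=; set s1 := set_reg _ _ _.
  have bs1 : bounded W s1 by apply: bounded_set_reg => //; apply: bs.2.
  have fs1 : frame s1 by apply: frame_loop.
  have Js1 : J x k s1 by apply: (Jst) Js; apply: same_set.
  have s1V : reg s1 rV = nth 0 (row L x) k.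
    by rewrite /= /upd /= sA (Jinp _ _ _ Js) ?nth_encode_row //; lia.
  apply: ok_seq; apply: ok_weaken (ok_frame bs1 (wp_ok W6 bs1 (Hbody _ _ _ hx hk _ s1V fs1 Js1))) _ _ => //.
  move=> s2 [Js2 bs2 hs2 _].
  have s2A : reg s2 rA = row_start L x + k by rewrite hs2 ?hb.
  have fs2 : frame s2.
    by apply: frame_sub fs1 _ hs2 => r /= ->; rewrite !orbT.
  apply: (@wp_ok _ (Add _ _ _)) => //=.
  rewrite s2A (fs2 _ nO) sOne; split; first by lia.
  split.
  - by apply: bounded_set_reg => //; lia.
  - by rewrite /= /upd /= hs2 ?hb // addn1 addnS.
  - by rewrite /= /upd /= hs2 ?hb.
  - exact: frame_loop.
  - by apply: (Jst) Js2; apply: same_set.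
have outer : forall s, Ou 0 s -> ok W (While (TestLt rX rN)
    (Seq (Seq (Add rT1 rX rOne) (Seq (Add rT1 rT1 rOne) (Read rE rT1)))
    (Seq (While (TestLt rA rE)
           (Seq (Read rV rA) (Seq body (Add rA rA rOne))))
    (Seq post (Add rX rX rOne))))) s
    (\sum_(0 <= x < n) (3 + ((\sum_(0 <= k < size (row L x)) (1 + (cost body + 1)).+1).+1 + (cost post + 1))).+1).+1 (Ou n).
  move=> s; apply: ok_loop => [x {}s hx|{}s]; last first.
    by case=> bs sX sA fs Js; rewrite /= sX (fs _ nN) sN ltnn.
  case=> bs sX sA fs Js; split.
    by rewrite /= sX (fs _ nN) sN.
  have hend := row_size_le hx.
  apply: ok_seq; apply: (@wp_ok _ (Seq _ (Seq _ _))) => //=.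
  rewrite /upd /= sX (fs _ nO) sOne; split; first by lia.
  split; first by lia.
  (* Cell x + 2 holds the start of row x + 1, which is the end of row x. *)
  rewrite (Jinp _ _ _ Js); last by lia.
  rewrite addn1 addn1 nth_encode_start //.
  set s1 := set_reg _ _ _.
  have bs1 : bounded W s1.
    by do 3!(apply: bounded_set_reg; first by [lia | apply: leq_trans (row_start_le _ _) _; lia]).
  have fs1 : frame s1 by do 3!apply: (frame_loop) => //.
  have Js1 : J x 0 s1 by do 3!(apply: (Jst); first by apply: (same_set)).
  apply: ok_seq; apply: ok_weaken (inner x s1 hx _) _ _ => //.
    by split=> //=; rewrite /upd //= addn0.
  move=> s2 [bs2 [s2X s2A] s2E fs2 Js2].
  apply: ok_seq; apply: ok_weaken (ok_frame bs2 (wp_ok W6 bs2 (Hpost _ _ hx s2X fs2 Js2))) _ _ => //.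
  move=> s3 [Js3 bs3 hs3 _].
  have fs3 : frame s3.
    by apply: frame_sub fs2 _ hs3 => r /= ->; rewrite !orbT.
  apply: (@wp_ok _ (Add _ _ _)) => //=.
  rewrite hs3 ?hp // s2X (fs3 _ nO) sOne; split; first by lia.
  split.
  - by apply: bounded_set_reg => //; lia.
  - by rewrite /= /upd /= addn1.
  - by rewrite /= /upd /= hs3 ?hp // row_startS.
  - exact: frame_loop.
  - by apply: (Jst) Js3; apply: same_set.
apply: ok_weaken (ok_seq (ok_weaken (wp_ok W6 bs0 init) (leqnn _) outer)) _ _; last first.
  by move=> s [].
under eq_bigr => x _ do rewrite sum_nat_const_nat subn0.
(* Each row is charged its overhead and one [post], each arc one [body]; this is where the nested
   loops become linear in U. *)
have -> : \sum_(0 <= x < n) (3 + ((size (row L x) * (1 + (cost body + 1)).+1).+1 + (cost post + 1))).+1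
  = n * (6 + cost post) + size (flatten L) * (cost body + 3).
  rewrite -sum_row_size big_distrl /= -[n in n * _]subn0 -sum_nat_const_nat -big_split /=.
  by apply: eq_bigr => x _; lia.
rewrite /=; nia.
Qed.
End Sweep.

(** * Breadth-first search and selection *)

Local Notation rLev := 16.
Local Notation rPar := 17.
Local Notation rK := 18.
Local Notation rK1 := 19.
Local Notation rP := 20.
Local Notation rQ := 21.
Local Notation rRelax := 22.
Local Notation rF := 23.
Local Notation rG := 24.
Local Notation rCnt := 25.
Local Notation rBest := 26.
Local Notation rR := 27.
Local Notation rAdj := 28.

Definition pass_body :=
  Seq (Add rT2 rLev rX) (Seq (Read rT3 rT2)
  (If (TestEq rT3 rK)
    (Seq (Add rT2 rLev rV) (Seq (Read rT3 rT2)
    (If (TestEq rT3 rZero)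
      (Seq (Write rT2 rK1) (Seq (Add rT2 rPar rV) (Write rT2 rX)))
      Skip)))
    Skip)).

(** Only rows of level d act and only level d + 1 is written, so a vertex reached during the sweep
    does not act before the next pass. *)
Definition pass d :=
  Seq (Seq (Const rK d) (Const rK1 d.+1)) (sweep pass_body Skip).

(* The level stored for a vertex is its distance to the root plus one, and 0
   for a vertex that has not been reached. *)
Definition bfs p :=
  Seq (Seq (Add rT2 rLev p) (Write rT2 rOne))
  (Seq (pass 1) (Seq (pass 2) (Seq (pass 3) (pass 4)))).

(* Finds, among the vertices x of level k with x adjacent to p (unless rl) and
   not adjacent to q, one with as many neighbours of level k+1 as possible.
   rBest ends as 0 if there is none, and as that number plus one otherwise. *)
Definition select_body :=
  Seq (If (TestEq rV rP) (Const rF 1) Skip)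
  (Seq (If (TestEq rV rQ) (Const rG 1) Skip)
  (Seq (Add rT2 rLev rV) (Seq (Read rT2 rT2)
  (If (TestEq rT2 rK1) (Add rCnt rCnt rOne) Skip)))).

(** The count is raised by one before the comparison, so that a candidate of score 0 still beats the
    initial 0 of rBest. Resetting rF to rRelax makes the adjacency test succeed from the outset when
    it is relaxed. *)
Definition select_post :=
  Seq (Add rT2 rLev rX) (Seq (Read rT2 rT2) (Seq (Add rCnt rCnt rOne)
  (Seq (If (TestEq rT2 rK) (If (TestEq rF rOne) (If (TestEq rG rZero)
         (If (TestLt rBest rCnt)
           (Seq (Add rBest rCnt rZero) (Add rR rX rZero)) Skip) Skip) Skip) Skip)
  (Seq (Add rF rRelax rZero) (Seq (Const rG 0) (Const rCnt 0)))))).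

Definition select_init k (rl : bool) p q :=
  Seq (Add rP p rZero) (Seq (Add rQ q rZero)
  (Seq (Const rK k) (Seq (Const rK1 k.+1)
  (Seq (Const rRelax rl) (Seq (Const rF rl)
  (Seq (Const rG 0) (Seq (Const rCnt 0) (Const rBest 0)))))))).

Definition select k rl p q :=
  Seq (select_init k rl p q) (sweep select_body select_post).

Definition adjacent p q :=
  Seq (Const rAdj 0)
  (sweep (If (TestEq rX p) (If (TestEq rV q) (Const rAdj 1) Skip) Skip) Skip).

(** * Correctness of the search, the selection and the adjacency test *)

Section Phases.
Variables (L : seq (seq nat)) (W : nat).
Local Notation n := (size L).
Local Notation U := (n + size (flatten L)).
Hypothesis n_gt0 : 0 < n.
Hypothesis hW : 7 * U <= W.
Hypothesis row_lt : forall x w, x < n -> w \in row L x -> w < n.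

(** Local conditions for a search cut off at depth d: [tree_par] yields a walk from r to x with
    [lev x] - 1 edges, and [tree_next] forbids a shorter one and forces every vertex at distance
    less than d to be reached. *)
Record bfs_tree d r (lev par : nat -> nat) : Prop := BfsTree {
  tree_root : lev r = 1;
  tree_one : forall x, x < n -> lev x = 1 -> x = r;
  tree_le : forall x, x < n -> lev x <= d;
  tree_par : forall x, x < n -> 1 < lev x ->
    [/\ par x < n, x \in row L (par x) & lev x = (lev (par x)).+1];
  tree_next : forall x w, x < n -> w \in row L x -> 0 < lev x -> lev x < d ->
    0 < lev w <= (lev x).+1 }.

(** The tree in the midst of pass d: level d + 1 is allowed, and the last two fields say that the
    arcs read so far out of level d end in reached vertices. *)
Record pass_inv d r (lev par : nat -> nat) x k : Prop := PassInv {
  pass_root : lev r = 1;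
  pass_one : forall y, y < n -> lev y = 1 -> y = r;
  pass_le : forall y, y < n -> lev y <= d.+1;
  pass_par : forall y, y < n -> 1 < lev y ->
    [/\ par y < n, y \in row L (par y) & lev y = (lev (par y)).+1];
  pass_next : forall y w, y < n -> w \in row L y -> 0 < lev y -> lev y < d ->
    0 < lev w <= (lev y).+1;
  pass_rows : forall y w, y < x -> y < n -> w \in row L y -> lev y = d -> 0 < lev w;
  pass_row : forall w, x < n -> w \in take k (row L x) -> lev x = d -> 0 < lev w }.

Lemma pass_inv0 d r lev par : bfs_tree d r lev par -> pass_inv d r lev par 0 0.
Proof.
by case=> h1 h2 h3 h4 h5; split=> //; [move=> y /h3; lia | rewrite take0].
Qed.

Lemma pass_inv_next_row d r lev par x :
  pass_inv d r lev par x (size (row L x)) -> pass_inv d r lev par x.+1 0.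
Proof.
case=> h1 h2 h3 h4 h5 h6; rewrite take_size => h7; split=> //; last by rewrite take0.
move=> y w; rewrite ltnS leq_eqVlt => /orP[/eqP->|]; first by move=> *; apply: h7.
exact: h6.
Qed.

Lemma pass_inv_end d r lev par : pass_inv d r lev par n 0 -> bfs_tree d.+1 r lev par.
Proof.
case=> h1 h2 h3 h4 h5 h6 h7; split=> // x w hx hw h0 hd.
have [hd'|hd'] := ltnP (lev x) d; first exact: h5.
have e : lev x = d by lia.
by rewrite (h6 x) //= e h3 // (row_lt hx).
Qed.

(** The flag b tells whether w receives a level. It does so only if its level was 0, so positive
    levels never change and all earlier conditions persist. *)
Lemma pass_inv_step d r lev par lev' par' x k w :
  0 < d -> r < n -> x < n -> k < size (row L x) -> nth 0 (row L x) k = w ->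
  let b := (lev x == d) && (lev w == 0) in
  (forall y, y < n -> lev' y = if b && (y == w) then d.+1 else lev y) ->
  (forall y, y < n -> par' y = if b && (y == w) then x else par y) ->
  pass_inv d r lev par x k -> pass_inv d r lev' par' x k.+1.
Proof.
move=> d0 hr hx hk ew b El Ep [h1 h2 h3 h4 h5 h6 h7].
have hwx : w \in row L x by rewrite -ew mem_nth.
have hw : w < n := row_lt hx hwx.
have El0 y : y < n -> 0 < lev y -> lev' y = lev y.
  by move=> hy; rewrite El // /b; case: eqP => //=; case: eqP => //= hw0 _; case: eqP => // ->; lia.
have El1 y : y < n -> lev' y = lev y \/ (b /\ y = w /\ lev' y = d.+1).
  by move=> hy; rewrite El //; case: ifP => [/andP[? /eqP]|]; [right | left].
split.
- by rewrite El0 ?h1.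
- by move=> y hy; case: (El1 y hy) => [->|[_ [_ ->]]]; [exact: h2 | lia].
- by move=> y hy; case: (El1 y hy) => [->|[_ [_ ->]]]; [exact: h3 | lia].
- move=> y hy hl; rewrite Ep //; case: ifP => [/andP[hb /eqP ey]|hb].
    have [/eqP e1 _] := andP hb.
    by split=> //; [rewrite ey | rewrite El // ey hb eqxx El0 ?e1 //; lia].
  rewrite (El y) // hb in hl *; have [? ? e] := h4 y hy hl; split=> //.
  by rewrite El0 //; lia.
- move=> y z hy hz; have hzn := row_lt hy hz.
  case: (El1 y hy) => [->|[_ [_ ->]]]; last by lia.
  move=> h0 hd; have /andP[z0 zl] := h5 y z hy hz h0 hd.
  by rewrite El0 // z0.
- move=> y z hyx hy hz; have hzn := row_lt hy hz.
  case: (El1 y hy) => [->|[_ [_ ->]]]; last by lia.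
  by move=> e; rewrite El0 //; apply: (h6 y).
- move=> z _; rewrite (take_nth 0) // ew mem_rcons inE => hz.
  case: (El1 x hx) => [->|[_ [_ ->]]]; last by lia.
  move=> e; case/orP: hz => [/eqP->|hz].
    have [hw0|] := posnP (lev w); last by move=> ?; rewrite El0.
    by rewrite El // /b e hw0 !eqxx.
  rewrite El0 ?(row_lt hx (mem_take hz)) //; exact: h7.
Qed.

Definition lev_of s x := ram s (reg s rLev + x).
Definition par_of s x := ram s (reg s rPar + x).

Definition arrays s :=
  [/\ input_end L <= reg s rLev, reg s rLev + n <= reg s rPar & reg s rPar + n <= W].

Definition same_outside s s' := forall a,
  (a < reg s rLev) || (reg s rPar + n <= a) -> ram s' a = ram s a.

Lemma pass_ok d r s : 0 < d < 6 -> r < n -> ready L W s -> arrays s ->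
  bfs_tree d r (lev_of s) (par_of s) ->
  ok W (pass d) s (23 * U) (fun s' =>
    bfs_tree d.+1 r (lev_of s') (par_of s') /\ same_outside s s').
Proof.
move=> /andP[d0 d6] hr rs [a1 a2 a3] tr.
have [bs sN s1 s0 inp] := rs; have W6 := word_ge6 n_gt0 hW.
apply: (@ok_weaken _ _ _ (2 + 21 * U) _ _ _ _ _ (fun _ h => h)); last by lia.
have pre : wp W (Seq (Const rK d) (Const rK1 d.+1)) (fun s' => [/\ reg s' rK = d, reg s' rK1 = d.+1,
   forall r, r != rK -> r != rK1 -> reg s' r = reg s r & ram s' = ram s]) s.
  split; first by lia.
  split; first by [].
  by split=> //= q h1 h2; rewrite /upd (negbTE h1) (negbTE h2).
apply: ok_seq; apply: ok_weaken (ok_frame bs (wp_ok W6 bs pre)) _ _ => // s2.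
case=> -[s2K s2K1 s2r s2m] bs2 _ _.
set lv := reg s rLev in a1 a2 a3 *; set pr := reg s rPar in a2 a3 *.
pose J x k t := pass_inv d r (fun y => ram t (lv + y)) (fun y => ram t (pr + y)) x k /\ same_outside s t.
have rs2 : ready L W s2 by split=> //; rewrite ?s2r // /holds_input s2m.
have stJ x k t t' : same_but_loop_regs t t' -> J x k t -> J x k t'.
  by rewrite /J /same_outside; case=> _ ->.
have H := @sweep_ok L W n_gt0 hW pass_body Skip J s2 rs2 isT _ stJ.
apply: ok_weaken (ok_frame bs2 (H _ _ _ _)) _ _ => {H}.
- by move=> x k t [_ hb] a ha; rewrite hb ?inp // (leq_trans ha a1).
- move=> x k t hx hk tX tV ft [Jt bt].
  have tL : reg t rLev = lv by rewrite ft // s2r.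
  have tP : reg t rPar = pr by rewrite ft // s2r.
  have tK : reg t rK = d by rewrite ft.
  have tK1 : reg t rK1 = d.+1 by rewrite ft.
  have t0 : reg t rZero = 0 by rewrite ft // s2r.
  have hw : nth 0 (row L x) k < n by apply: row_lt hx _; apply: mem_nth.
  set w := nth 0 (row L x) k in tV hw.
  rewrite /= /upd /= tX tV tL tP tK tK1 t0.
  have e y z c : (c + y == c + z) = (y == z) by rewrite eqn_add2l.
  (* All branches end here: only the contents of the two arrays and of the cells outside them
     matter, not the registers. *)
  have Jstep m : (forall a, (a < lv) || (pr + n <= a) -> m a = ram t a) ->
      (forall y, y < n -> m (lv + y) = if (ram t (lv + x) == d) && (ram t (lv + w) == 0) && (y == w) then d.+1 else ram t (lv + y)) ->
      (forall y, y < n -> m (pr + y) = if (ram t (lv + x) == d) && (ram t (lv + w) == 0) && (y == w) then x else ram t (pr + y)) ->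
      forall g, J x k.+1 (State g m).
    move=> hm h1 h2 g; split=> /=; last by move=> a ha /=; rewrite hm // bt.
    exact: (pass_inv_step d0 hr hx hk (erefl _) h1 h2 Jt).
  split; first by lia.
  split=> [/eqP ex|nx].
    split; first by lia.
    split=> [/eqP ew|nw].
      split; first by lia.
      apply: Jstep => [a ha|y hy|y hy].
      - by rewrite /= /upd !ifN //; apply/eqP; lia.
      - rewrite /= /upd ifN; last by apply/eqP; lia.
        by rewrite e ex ew eqxx.
      - rewrite /= /upd e ex ew eqxx /=; case: eqP => // _.
        by rewrite ifN //; apply/eqP; lia.
    by apply: Jstep => // y _; rewrite (negbTE nw) andbF.
  by apply: Jstep => // y _; rewrite (negbTE nx).
- by move=> x t hx _ _ [Jt bt]; split=> //; apply: pass_inv_next_row.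
- by split; [rewrite s2m; apply: pass_inv0 | rewrite /same_outside s2m].
- by rewrite /=; lia.
- move=> s3 [[J3 b3] _ f3 _]; split=> //.
  rewrite /lev_of /par_of !f3 // !s2r //; exact: pass_inv_end.
Qed.

Lemma ready_mono s s' : ready L W s -> bounded W s' ->
  (forall r, r \in [:: rN; rOne; rZero] -> reg s' r = reg s r) ->
  (forall a, a < input_end L -> ram s' a = ram s a) -> ready L W s'.
Proof.
move=> [bs sN s1 s0 inp] bs' hr hm; split; rewrite ?hr //.
by move=> a ha; rewrite hm ?inp.
Qed.

(** The level array must start out blank, 0 being the mark of an unreached vertex; the parent array
    may hold anything, as [tree_par] concerns levels above 1 only. *)
Lemma bfs_ok p r s : r < n -> ready L W s -> arrays s ->
  reg s p = r -> (forall x, x < n -> lev_of s x = 0) ->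
  ok W (bfs p) s (94 * U) (fun s' =>
    bfs_tree 5 r (lev_of s') (par_of s') /\ same_outside s s').
Proof.
move=> hr rs ar sp l0.
have [bs sN s1 s0 inp] := rs; have W6 := word_ge6 n_gt0 hW; have [a1 a2 a3] := ar.
apply: (@ok_weaken _ _ _ (2 + (23 * U + (23 * U + (23 * U + 23 * U)))) _ _ _ _ _
  (fun _ h => h)); last by lia.
pose good d t := [/\ ready L W t, reg t rLev = reg s rLev, reg t rPar = reg s rPar,
  same_outside s t & bfs_tree d r (lev_of t) (par_of t)].
have step d t : 0 < d < 6 -> good d t -> ok W (pass d) t (23 * U) (good d.+1).
  move=> hd [rt tL tP bt tr]; have [b _ _ _ _] := rt.
  have art : arrays t by rewrite /arrays tL tP.
  apply: ok_weaken (ok_frame b (pass_ok hd hr rt art tr)) _ _ => // t'.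
  case=> -[tr' bt'] b' ft' _; split; rewrite ?ft' //.
    apply: ready_mono rt b' _ _ => [q|a ha].
      by rewrite !inE => /or3P[] /eqP->; apply: ft'.
    by rewrite bt' // tL (leq_trans ha a1).
  by move=> a ha; rewrite bt' ?tL ?tP // bt.
apply: ok_seq.
have pre : wp W (Seq (Add rT2 rLev p) (Write rT2 rOne)) (good 1) s.
  rewrite /= /upd /= sp s1; split; first by lia.
  have low a : (a < reg s rLev) || (reg s rPar + n <= a) ->
      a == reg s rLev + r = false.
    by move=> ?; apply/eqP; lia.
  split=> //=.
  - split=> //=.
      by split=> a /=; apply: upd_bounded => //; [lia | apply: bs.1 | lia | apply: bs.2].
    move=> a ha /=; by rewrite /upd low ?inp // (leq_trans ha a1).
  - by move=> a ha /=; rewrite /upd low.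
  set t := set_mem _ _ _.
  have levE x : x < n -> lev_of t x = (x == r).
    by move=> hx; rewrite /lev_of /= /upd /= eqn_add2l; case: eqP => // _; apply: l0.
  split.
  - by rewrite levE ?eqxx.
  - by move=> x hx; rewrite levE //; case: eqP.
  - by move=> x hx; rewrite levE //; case: eqP.
  - by move=> x hx; rewrite levE //; case: eqP.
  - by move=> x w hx _; rewrite levE //; case: eqP.
apply: ok_weaken (ok_frame bs (wp_ok W6 bs pre)) _ _ => // t1 [g1 _ _ _].
apply: ok_seq; apply: ok_weaken (step 1 _ isT g1) _ _ => // t2 g2.
apply: ok_seq; apply: ok_weaken (step 2 _ isT g2) _ _ => // t3 g3.
apply: ok_seq; apply: ok_weaken (step 3 _ isT g3) _ _ => // t4 g4.
by apply: ok_weaken (step 4 _ isT g4) _ _ => // t5 [].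
Qed.

Definition candidate (lev : nat -> nat) k (rl : bool) p q x :=
  [&& lev x == k, rl || (p \in row L x) & q \notin row L x].

Definition score (lev : nat -> nat) k x := count (fun w => lev w == k.+1) (row L x).

(** The shift by one makes b = 0 say that no candidate has been seen. *)
Definition best_below (C : pred nat) (f : nat -> nat) x b r :=
  (forall y, y < x -> C y -> f y < b) /\ (0 < b -> [/\ r < x, C r & (f r).+1 = b]).

(** [q != rP] is required because rP is overwritten before q is copied. *)
Lemma select_ok k rl p q s : k < 6 -> q != rP -> ready L W s -> arrays s ->
  ok W (select k rl p q) s (39 * U) (fun s' => ram s' = ram s /\
    best_below (candidate (lev_of s) k rl (reg s p) (reg s q)) (score (lev_of s) k) n
      (reg s' rBest) (reg s' rR)).
Proof.
move=> hk hq rs [a1 a2 a3].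
have [bs sN s1 s0 inp] := rs; have W6 := word_ge6 n_gt0 hW.
apply: (@ok_weaken _ _ _ (9 + 30 * U) _ _ _ _ _ (fun _ h => h)); last by lia.
have rl6 : rl <= 6 by case: (rl).
set P := reg s p; set Q := reg s q; set lv := reg s rLev in a1 a2 a3 *.
set C := candidate _ _ _ _ _; set f := score _ _.
have pre : wp W (select_init k rl p q) (fun s' =>
    [/\ [/\ reg s' rP = P, reg s' rQ = Q, reg s' rK = k & reg s' rK1 = k.+1],
     [/\ reg s' rRelax = rl, reg s' rF = rl, reg s' rG = 0, reg s' rCnt = 0 & reg s' rBest = 0]
     & ram s' = ram s]) s.
  rewrite /select_init /= /upd /= (negbTE hq) s0 /= !addn0; case: bs => bs1 bs2.
  by do 2!(split; first by apply: bs1); do !split=> //; lia.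
apply: ok_seq; apply: ok_weaken (ok_frame bs (wp_ok W6 bs pre)) _ _ => // s2.
case=> -[[s2P s2Q s2K s2K1] [s2rl s2F s2G s2C s2B] s2m] bs2 f2 _.
pose J x j t := [/\ ram t = ram s,
  [/\ reg t rF = rl || (P \in take j (row L x)), reg t rG = (Q \in take j (row L x)) &
   reg t rCnt = count (fun w => lev_of s w == k.+1) (take j (row L x))] &
  best_below C f x (reg t rBest) (reg t rR)].
have rs2 : ready L W s2 by split=> //; rewrite ?f2 // /holds_input s2m.
have stJ x j t t' : same_but_loop_regs t t' -> J x j t -> J x j t'.
  by rewrite /J; case=> hr ->; rewrite !hr.
have H := @sweep_ok L W n_gt0 hW select_body select_post J s2 rs2 isT _ stJ.
apply: ok_weaken (ok_frame bs2 (H _ _ _ _)) _ _ => {H}.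
- by move=> x j t [hm _ _] a ha; rewrite hm inp.
- move=> x j t hx hj tX tV ft [tm [tF tG tC] hb].
  have tL : reg t rLev = lv by rewrite ft // f2.
  have tP : reg t rP = P by rewrite ft.
  have tQ : reg t rQ = Q by rewrite ft.
  have tK1 : reg t rK1 = k.+1 by rewrite ft.
  have t1 : reg t rOne = 1 by rewrite ft // f2.
  have hw : nth 0 (row L x) j < n by apply: row_lt hx _; apply: mem_nth.
  set w := nth 0 (row L x) j in tV hw.
  have hin z : (z \in take j.+1 (row L x)) = (w == z) || (z \in take j (row L x)).
    by rewrite (take_nth 0) // mem_rcons inE eq_sym.
  have hcount (a : pred nat) : count a (take j.+1 (row L x)) = count a (take j (row L x)) + a w.
    by rewrite (take_nth 0) // -cats1 count_cat /= addn0.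
  have hcle : count (fun w => lev_of s w == k.+1) (take j (row L x)) < W.
    apply: leq_ltn_trans (count_size _ _) _; rewrite size_take hj.
    have := row_size_le hx; have := input_endE L; lia.
  rewrite /= /upd /= tV tL tP tQ tK1 t1 tm tC.
  have hlv : lv + w <= W by lia.
  rewrite -/(lev_of s w).
  (* Three independent tests give eight cases, in each of which the two flags and the counter take
     in the entry w. *)
  split=> e1; [split; first by []|move/negbTE: e1 => e1];
  (split=> e2; [split; first by []|move/negbTE: e2 => e2]);
  (split; first by []);
  (split=> e3; [split; first by lia|move/negbTE: e3 => e3]);
  by rewrite /J /= /upd /= !hin hcount e1 e2 e3 /= ?orbT ?addn0.
- move=> x t hx tX ft [tm [tF tG tC] hb].
  have tL : reg t rLev = lv by rewrite ft // f2.
  have tK : reg t rK = k by rewrite ft.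
  have tR : reg t rRelax = rl by rewrite ft.
  have t1 : reg t rOne = 1 by rewrite ft // f2.
  have t0 : reg t rZero = 0 by rewrite ft // f2.
  have {}tC : reg t rCnt = f x by rewrite tC take_size.
  rewrite take_size in tF tG.
  have fx : f x < W.
    apply: leq_ltn_trans (count_size _ _) _.
    have := row_size_le hx; have := input_endE L; lia.
  rewrite /= /upd /= tX tL tK tR t1 t0 tm tC tF tG -/(lev_of s x) !addn0 !eqb1 !eqb0 negbK.
  have Jnext t' : ram t' = ram s -> [/\ reg t' rF = rl, reg t' rG = 0 & reg t' rCnt = 0] ->
      best_below C f x.+1 (reg t' rBest) (reg t' rR) -> J x.+1 0 t'.
    by move=> hm [hF hG hC] hb'; split=> //; rewrite take0 in_nil orbF.
  have Cx : C x = [&& lev_of s x == k, rl || (P \in row L x) & Q \notin row L x] by [].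
  have rlW : rl <= W by lia.
  (* Each of the four tests can fail, and then the best so far stands: x is no candidate or its
     score does not exceed the record. *)
  have skip b r : best_below C f x b r -> C x = false \/ f x < b -> best_below C f x.+1 b r.
    move=> [h1 h2] h; split=> [y|/h2[]]; last by move=> *; split=> //; lia.
    rewrite ltnS leq_eqVlt => /orP[/eqP->|]; last exact: h1.
    by case: h => [->|].
  split; first by lia.
  split; first by lia.
  split=> [e1|/negbTE e1]; last first.
    split=> //; split=> //; split=> //; apply: Jnext => //=; rewrite /upd /=.
    by apply: skip => //; left; rewrite Cx e1.
  split=> [e2|/negbTE e2]; last first.
    split=> //; split=> //; split=> //; apply: Jnext => //=; rewrite /upd /=.
    by apply: skip => //; left; rewrite Cx e1 e2.
  split=> [e3|e3]; last first.
    split=> //; split=> //; split=> //; apply: Jnext => //=; rewrite /upd /=.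
    by apply: skip => //; left; rewrite Cx e3 !andbF.
  split=> e4; last first.
    split=> //; split=> //; split=> //; apply: Jnext => //=; rewrite /upd /=.
    by apply: skip => //; right; lia.
  split; first by lia.
  split; first by lia.
  split=> //; split=> //; split=> //; apply: Jnext => //=; rewrite /upd /=.
  have CxT : C x by rewrite Cx e1 e2 e3.
  case: hb => h1 h2; split=> [y|_]; last by split=> //; lia.
  rewrite ltnS leq_eqVlt => /orP[/eqP-> _|hy hC]; first by lia.
  by have := h1 y hy hC; lia.
- split=> //; first by rewrite take0 in_nil orbF.
  by rewrite s2B; split.
- by rewrite /=; lia.
- by move=> s3 [[m3 _ b3] _ _ _].
Qed.

Lemma adjacent_ok p q s : p \notin rAdj :: loop_regs ->
  q \notin rAdj :: loop_regs -> ready L W s -> reg s p < n ->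
  ok W (adjacent p q) s (15 * U) (fun s' => ram s' = ram s /\
    reg s' rAdj = (reg s q \in row L (reg s p))).
Proof.
move=> hp hq rs pn; have [bs sN s1 s0 inp] := rs; have W6 := word_ge6 n_gt0 hW.
apply: (@ok_weaken _ _ _ (1 + 14 * U) _ _ _ _ _ (fun _ h => h)); last by lia.
apply: ok_seq; apply: (@wp_ok _ (Const _ _)) => //; split=> //.
set s2 := set_reg _ _ _; set P := reg s p in pn *; set Q := reg s q.
have bs2 : bounded W s2 by apply: bounded_set_reg => //; lia.
have rs2 : ready L W s2 by split.
have s2P : reg s2 p = P.
  by move: hp; rewrite inE => /norP[h _]; rewrite /= /upd (negbTE h).
have s2Q : reg s2 q = Q.
  by move: hq; rewrite inE => /norP[h _]; rewrite /= /upd (negbTE h).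
(* The flag is 0 before row P, tracks its first j entries during row P, and is final afterwards. *)
pose J x j t := ram t = ram s /\ reg t rAdj =
  if P < x then Q \in row L P else (x == P) && (Q \in take j (row L P)).
have stJ x j t t' : same_but_loop_regs t t' -> J x j t -> J x j t'.
  by rewrite /J; case=> hr ->; rewrite !hr.
set body := If _ _ _.
have na r : r \notin rAdj :: loop_regs -> ~~ assigned r (sweep body Skip).
  by rewrite /= !inE; lia.
have H := @sweep_ok L W n_gt0 hW body Skip J s2 rs2 isT _ stJ.
apply: ok_weaken (ok_frame bs2 (H _ _ _ _)) _ _ => {H}.
- by move=> x j t [hm _] a ha; rewrite hm inp.
- move=> x j t hx hj tX tV ft [tm tA].
  have tP : reg t p = P by rewrite ft // na.
  have tQ : reg t q = Q by rewrite ft // na.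
  rewrite /= /upd /= tX tV tP tQ.
  have hin : (Q \in take j.+1 (row L x)) = (nth 0 (row L x) j == Q) || (Q \in take j (row L x)).
    by rewrite (take_nth 0) // mem_rcons inE eq_sym.
  split=> [/eqP e1|/negbTE e1]; last by rewrite /J tm tA e1.
  rewrite /J -e1 ltnn eqxx /= hin; rewrite -e1 ltnn eqxx in tA.
  by split=> [->|/negbTE->].
- move=> x t hx _ _ [tm tA]; split=> //; rewrite tA ltnS take0 in_nil andbF.
  by case: ltngtP => // ->; rewrite take_size.
- by split=> //; rewrite /= take0 andbF.
- by rewrite /=; lia.
- by move=> s3 [[m3 b3] _ _ _]; rewrite m3 b3 pn.
Qed.
End Phases.

(** * Principal vertices and induced paths in labelled graphs *)

(** If every P-element of B lay in A, then A, having x in addition, would have more of them than B.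
    This is how the maximality of u and of y is used. *)
Lemma count_exchange (T : eqType) (P : pred T) (A B : seq T) x :
  uniq A -> uniq B -> count P A <= count P B -> x \in A -> P x -> x \notin B ->
  exists2 z, z \in B & P z && (z \notin A).
Proof.
move=> uA uB; rewrite -!size_filter => le xA Px xB.
have [/hasP//|/hasPn h] := boolP (has (fun z => P z && (z \notin A)) B).
suff: size (x :: filter P B) <= size (filter P A) by rewrite /= ltnNge le.
apply: uniq_leq_size => [|z]; first by rewrite /= filter_uniq // mem_filter Px xB.
rewrite inE !mem_filter => /orP[/eqP->|/andP[Pz zB]]; first by rewrite Px.
by have := h z zB; rewrite Pz /= negbK.
Qed.

Section LabelGraph.
Variable L : seq (seq nat).
Local Notation n := (size L).
Local Notation E x y := (y \in row L x).
Hypothesis row_lt : forall x w, x < n -> E x w -> w < n.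
Hypothesis row_sym : forall x y, x < n -> y < n -> E x y = E y x.
Hypothesis row_uniq : forall x, x < n -> uniq (row L x).
Hypothesis row_conn : forall (S : pred nat) r, r < n -> S r ->
  (forall x w, x < n -> E x w -> S x -> S w) -> forall x, x < n -> S x.

Definition induced_P5 a b c d e :=
  [&& [&& a < n, b < n, c < n, d < n & e < n],
      [&& E a b, E b c, E c d & E d e]
    & [&& ~~ E a c, ~~ E a d, ~~ E a e, ~~ E b d, ~~ E b e & ~~ E c e]].

Definition within2 r := forall x, x < n ->
  [\/ x = r, E r x | exists2 m, m < n & E r m && E m x].

(** * Distance layers of a search tree *)

Section Tree.
Variables (r : nat) (lev par : nat -> nat).
Hypothesis tree : bfs_tree L 5 r lev par.

Lemma tree_edge x : x < n -> 1 < lev x ->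
  [/\ par x < n, E (par x) x, E x (par x) & lev x = (lev (par x)).+1].
Proof. by move=> hx /(tree_par tree hx)[hp he el]; rewrite -(row_sym hp hx). Qed.

(** An edge raises the level by at most one. As [lev y] is at most 5, x lies below the last level,
    where [tree_next] applies. *)
Lemma tree_gap x y : x < n -> y < n -> 0 < lev x -> (lev x).+1 < lev y ->
  E x y = false /\ E y x = false.
Proof.
move=> hx hy l0 l1; rewrite [E y x]row_sym //; suff -> : E x y = false by [].
apply/negP => he; have := tree_le tree hy => l5.
have h5 : lev x < 5 by lia.
by have := tree_next tree hx he l0 h5; lia.
Qed.

Lemma tree_two x : x < n -> lev x = 2 -> E r x /\ E x r.
Proof.
move=> hx lx; have [|hp h1 h2 e] := tree_edge hx; first by rewrite lx.
by rewrite -(tree_one tree hp _) //; lia.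
Qed.

Hypothesis r_lt : r < n.

(** With level k + 1 empty, the vertices of levels 1 to k are closed under adjacency, and
    connectedness does the rest. *)
Lemma tree_cover k : 0 < k < 5 -> (forall x, x < n -> lev x != k.+1) ->
  forall x, x < n -> 0 < lev x <= k.
Proof.
move=> hk hn; apply: (row_conn r_lt); first by rewrite (tree_root tree); lia.
move=> x w hx he h; have hw := row_lt hx he.
have [h0 h5] : 0 < lev x /\ lev x < 5 by lia.
by have := tree_next tree hx he h0 h5; have := hn w hw; lia.
Qed.

Lemma tree_within2 : (forall x, x < n -> lev x != 4) -> within2 r.
Proof.
move=> h4 x hx; have := @tree_cover 3 isT h4 x hx.
have [h1|h1|h1] := ltngtP (lev x) 2; move=> h2.
- by apply: Or31; apply: (tree_one tree) => //; lia.
- have [|hp he _ el] := tree_edge hx; first by lia.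
  apply: Or33; exists (par x) => //; rewrite he andbT.
  by have [|] := tree_two hp; first by lia.
- by apply: Or32; have [] := tree_two hx h1.
Qed.

(** Consecutive vertices on the way along parents to the root differ by one level, so the others are
    at least two levels apart and [tree_gap] excludes chords. *)
Lemma tree_deep_P5 x : x < n -> lev x = 5 ->
  induced_P5 r (par (par (par x))) (par (par x)) (par x) x.
Proof.
move=> hx l5; have [|hp e1 _ l1] := tree_edge hx; first by lia.
have [|hp2 e2 _ l2] := tree_edge hp; first by lia.
have [|hp3 e3 _ l3] := tree_edge hp2; first by lia.
have [|e4 _] := tree_two hp3; first by lia.
have lr := tree_root tree.
rewrite /induced_P5 r_lt hp3 hp2 hp hx e4 e3 e2 e1 /=.
by rewrite !(proj1 (tree_gap _ _ _ _)) //; lia.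
Qed.

End Tree.

(* Level k is the layer L(k-1) of the introduction; lev2 and par2 come from the
   search from u. *)
Record far_vertex v y u w (lev par lev2 par2 : nat -> nat) : Prop := FarVertex {
  fv_v_lt : v < n;
  fv_tree1 : bfs_tree L 5 v lev par;
  fv_no5 : forall x, x < n -> lev x != 5;
  fv_y_lt : y < n;
  fv_y_lev : lev y = 3;
  fv_y_max : forall a, a < n -> lev a = 3 -> score L lev 3 a <= score L lev 3 y;
  fv_u_lt : u < n;
  fv_u_lev : lev u = 2;
  fv_uy : E u y;
  fv_u_max : forall a, a < n -> lev a = 2 -> E a y ->
  score L lev 2 a <= score L lev 2 u;
  fv_tree2 : bfs_tree L 5 u lev2 par2;
  fv_w_lt : w < n;
  fv_w_lev2 : lev2 w = 4 }.

(** * The induced paths arising from a vertex w at distance 3 from u *)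

Section Center.
Variables (v y u w : nat) (lev par lev2 par2 : nat -> nat).
Hypothesis fv : far_vertex v y u w lev par lev2 par2.

Lemma far_no_edge : E u w = false /\ E w u = false.
Proof.
have [v_lt tree1 no5 y_lt y_lev y_max u_lt u_lev uy u_max tree2 w_lt w_lev2] := fv.
by apply: (tree_gap tree2) => //; rewrite (tree_root tree2) ?w_lev2.
Qed.

(** A neighbour of u has level at most 2 in the search from u, while w has level 4. *)
Lemma far_no_common m : m < n -> E u m -> E m w = false /\ E w m = false.
Proof.
have [v_lt tree1 no5 y_lt y_lev y_max u_lt u_lev uy u_max tree2 w_lt w_lev2] := fv.
move=> hm he; have := tree_next tree2 u_lt he; rewrite (tree_root tree2) => /(_ isT isT) h.
by apply: (tree_gap tree2) => //; rewrite ?w_lev2; lia.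
Qed.

(** Since v is adjacent to u, both v and its neighbours are within distance 2 of u, which excludes
    levels 1 and 2; level 5 is empty. *)
Lemma far_level : lev w = 3 \/ lev w = 4.
Proof.
have [v_lt tree1 no5 y_lt y_lev y_max u_lt u_lev uy u_max tree2 w_lt w_lev2] := fv.
have := @tree_cover v lev par tree1 v_lt 4 isT no5 w w_lt.
have [vu uv] := tree_two tree1 u_lt u_lev.
have [h|h|h] := ltngtP (lev w) 2; try lia.
  move=> h0; have e : w = v by apply: (tree_one tree1) => //; lia.
  by have [] := far_no_edge; rewrite e uv.
have [vw _] := tree_two tree1 w_lt h.
by have [] := far_no_common v_lt uv; rewrite vw.
Qed.

Section Near.
Hypothesis w_lev : lev w = 3.
Local Notation u' := (par w).

(** If u' is not adjacent to y, then y itself serves. Otherwise u' took part in the choice of u, and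
    as u' is adjacent to w but u is not, the exchange gives z. *)
Lemma near_candidate : exists2 z, z < n & candidate L lev 3 false u u' z.
Proof.
have [v_lt tree1 no5 y_lt y_lev y_max u_lt u_lev uy u_max tree2 w_lt w_lev2] := fv.
have [|hu' e1 _ l1] := tree_edge tree1 w_lt; first by rewrite w_lev.
have [yu'|yu'] := boolP (E u' y); last first.
  by exists y => //; rewrite /candidate y_lev row_sym // uy row_sym.
have [uw _] := far_no_edge.
have [||||||z zu /andP[/eqP lz zu']] := @count_exchange _ (fun w => lev w == 3) (row L u') (row L u) w;
  rewrite ?row_uniq ?w_lev ?uw //.
  by apply: u_max => //; lia.
have z_lt := row_lt u_lt zu.
by exists z => //; rewrite /candidate lz -(row_sym u_lt) // zu -(row_sym hu').
Qed.

(** The non-edges have three sources: z and w lie two levels beyond v; w is at distance 3 from u,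
    which excludes uw, zw and uu'; and z was chosen off u'. *)
Lemma near_P5 z : z < n -> candidate L lev 3 false u u' z -> induced_P5 z u v u' w.
Proof.
have [v_lt tree1 no5 y_lt y_lev y_max u_lt u_lev uy u_max tree2 w_lt w_lev2] := fv.
move=> z_lt /and3P[/eqP lz zu zu']; rewrite /= in zu.
have [|hu' e1 e2 l1] := tree_edge tree1 w_lt; first by rewrite w_lev.
have lv := tree_root tree1.
have [vu uv] := tree_two tree1 u_lt u_lev.
have [|vu' u'v] := tree_two tree1 hu'; first by lia.
have [zv1 zv2] : E v z = false /\ E z v = false by apply: (tree_gap tree1); rewrite ?lv ?lz ?w_lev.
have [wv1 wv2] : E v w = false /\ E w v = false by apply: (tree_gap tree1); rewrite ?lv ?lz ?w_lev.
have [zw _] := far_no_common z_lt (etrans (row_sym u_lt z_lt) zu).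
have [uw _] := far_no_edge.
have uu' : E u u' = false.
  by apply/negP => h; have [] := far_no_common hu' h; rewrite e1.
by rewrite /induced_P5 z_lt u_lt v_lt hu' w_lt zu uv vu' e1 zv2 zu' zw uu' uw wv1.
Qed.

End Near.

Section Far.
Hypothesis w_lev : lev w = 4.
Local Notation a := (par w).
Local Notation u2 := (par a).

(** Being a neighbour of u, y is not adjacent to w, while a is; since a does not beat y in
    neighbours on level 4, the exchange applies. *)
Lemma far_candidate : exists2 c, c < n & candidate L lev 4 false y a c.
Proof.
have [v_lt tree1 no5 y_lt y_lev y_max u_lt u_lev uy u_max tree2 w_lt w_lev2] := fv.
have [|a_lt e1 _ l1] := tree_edge tree1 w_lt; first by rewrite w_lev.
have [yw _] := far_no_common y_lt uy.
have [||||||z zy /andP[/eqP lz za]] := @count_exchange _ (fun w => lev w == 4) (row L a) (row L y) w;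
  rewrite ?row_uniq ?w_lev ?yw //.
  by apply: y_max => //; lia.
have z_lt := row_lt y_lt zy.
by exists z => //; rewrite /candidate lz -(row_sym y_lt) // zy -(row_sym a_lt).
Qed.

Lemma far_parents : [/\ a < n, u2 < n, lev a = 3 & lev u2 = 2].
Proof.
have [v_lt tree1 no5 y_lt y_lev y_max u_lt u_lev uy u_max tree2 w_lt w_lev2] := fv.
have [|a_lt e1 _ l1] := tree_edge tree1 w_lt; first by rewrite w_lev.
have [|u2_lt e2 _ l2] := tree_edge tree1 a_lt; first by lia.
by split=> //; lia.
Qed.

(** The order of the tests matters: each path takes as non-edges pairs at which earlier tests
    failed. The other non-edges come from the levels, the distance of w from u, and the choice of
    c. *)
Lemma far_P5 c : c < n -> candidate L lev 4 false y a c ->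
  if E c w then induced_P5 v u y c w else
  if E y a then induced_P5 v u y a w else
  if E u2 y then induced_P5 c y u2 a w else
  if E u u2 then induced_P5 c y u u2 a else induced_P5 y u v u2 a.
Proof.
have [v_lt tree1 no5 y_lt y_lev y_max u_lt u_lev uy u_max tree2 w_lt w_lev2] := fv.
move=> c_lt /and3P[/eqP lc cy /negbTE ca]; rewrite /= in cy.
have [a_lt u2_lt la lu2] := far_parents.
have [|_ aw wa _] := tree_edge tree1 w_lt; first by rewrite w_lev.
have [|_ u2a au2 _] := tree_edge tree1 a_lt; first by rewrite la.
have lv := tree_root tree1.
have [vu uv] := tree_two tree1 u_lt u_lev.
have [vu2 u2v] := tree_two tree1 u2_lt lu2.
have gap := tree_gap tree1.
have [vy yv] : E v y = false /\ E y v = false by apply: gap; rewrite ?lv ?u_lev ?y_lev ?la ?lc ?lu2 ?w_lev.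
have [va av] : E v a = false /\ E a v = false by apply: gap; rewrite ?lv ?u_lev ?y_lev ?la ?lc ?lu2 ?w_lev.
have [vc cv] : E v c = false /\ E c v = false by apply: gap; rewrite ?lv ?u_lev ?y_lev ?la ?lc ?lu2 ?w_lev.
have [vw wv] : E v w = false /\ E w v = false by apply: gap; rewrite ?lv ?u_lev ?y_lev ?la ?lc ?lu2 ?w_lev.
have [uc cu] : E u c = false /\ E c u = false by apply: gap; rewrite ?lv ?u_lev ?y_lev ?la ?lc ?lu2 ?w_lev.
have [u2c cu2] : E u2 c = false /\ E c u2 = false by apply: gap; rewrite ?lv ?u_lev ?y_lev ?la ?lc ?lu2 ?w_lev.
have [u2w wu2] : E u2 w = false /\ E w u2 = false by apply: gap; rewrite ?lv ?u_lev ?y_lev ?la ?lc ?lu2 ?w_lev.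
have [uw _] := far_no_edge.
have [yw _] := far_no_common y_lt uy.
have yc : E y c by rewrite row_sym.
have yu : E y u by rewrite row_sym.
have ua : E u a = false.
  by apply/negP => h; have [] := far_no_common a_lt h; rewrite aw.
rewrite /induced_P5 v_lt u_lt y_lt a_lt c_lt w_lt u2_lt /= [E y u2]row_sym //.
case: ifP => cw; first by rewrite vu uy yc cw vy vc vw uc uw yw.
case: ifP => ya; first by rewrite vu uy ya aw vy va vw ua uw yw.
case: ifP => u2y; first by rewrite cy u2y u2a aw cu2 ca cw ya yw u2w.
case: ifP => uu2; first by rewrite cy yu uu2 u2a cu cu2 ca u2y ya ua.
by rewrite yu uv vu2 u2a yv u2y ya uu2 ua va.
Qed.

End Far.
End Center.
End LabelGraph.

(** * The algorithm *)

Local Notation rY := 29.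
Local Notation rU := 30.
Local Notation rW := 31.
Local Notation rB := 32.
Local Notation rC := 33.
Local Notation rD := 34.

Definition report1 a := Seq (Const 0 0) (Add 1 a rZero).

Definition report5 a b c d e :=
  Seq (Const 0 1) (Seq (Add 1 a rZero) (Seq (Add 2 b rZero)
  (Seq (Add 3 c rZero) (Seq (Add 4 d rZero) (Add 5 e rZero))))).

Definition parent dst src := Seq (Add rT2 rPar src) (Read dst rT2).

Definition near_prog :=
  Seq (parent rD rW) (Seq (select 3 false rU rD) (report5 rR rU rZero rD rW)).

Definition far_prog :=
  Seq (parent rB rW) (Seq (select 4 false rY rB) (Seq (Add rC rR rZero)
  (Seq (adjacent rC rW) (If (TestEq rAdj rOne) (report5 rZero rU rY rC rW)
  (Seq (adjacent rY rB) (If (TestEq rAdj rOne) (report5 rZero rU rY rB rW)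
  (Seq (parent rD rB)
  (Seq (adjacent rD rY) (If (TestEq rAdj rOne) (report5 rC rY rD rB rW)
  (Seq (adjacent rU rD) (If (TestEq rAdj rOne) (report5 rC rY rU rD rB)
    (report5 rY rU rZero rD rB)))))))))))).

(** The search from u gets fresh arrays behind the old ones. The two subtractions then point rLev
    and rPar back to the search from v, whose levels and parents the case analysis needs. *)
Definition center_prog :=
  Seq (Seq (Add rLev rPar rN) (Add rPar rLev rN))
  (Seq (bfs rU) (Seq (select 4 true rZero rN)
  (If (TestEq rBest rZero) (report1 rU)
  (Seq (Seq (Add rW rR rZero) (Seq (Defs.Sub rPar rLev rN) (Seq (Defs.Sub rLev rPar rN)
       (Seq (Add rT2 rLev rW) (Seq (Read rT2 rT2) (Const rT3 3))))))
  (If (TestEq rT2 rT3) near_prog far_prog))))).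

(** Cell n + 1 of the input gives the first free address, where the level array starts. At levels 5
    and 4 [select] is a test for emptiness, at level 5 also a source of a deep vertex; only at
    levels 3 and 2 does maximality count. Passing rN as q excludes nothing. *)
Definition main_prog :=
  Seq (Seq (Const rOne 1) (Seq (Read rN rZero) (Seq (Add rT2 rN rOne)
      (Seq (Read rLev rT2) (Add rPar rLev rN)))))
  (Seq (bfs rZero) (Seq (select 5 true rZero rN)
  (If (TestEq rBest rZero)
    (Seq (select 4 true rZero rN)
    (If (TestEq rBest rZero) (report1 rZero)
      (Seq (select 3 true rZero rN) (Seq (Add rY rR rZero)
      (Seq (select 2 false rY rN) (Seq (Add rU rR rZero) center_prog))))))
    (Seq (parent rY rR) (Seq (parent rU rY) (Seq (parent rW rU)
      (report5 rZero rW rU rY rR))))))).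

(** * Correctness and running time of the whole program *)

Section Main.
Variables (L : seq (seq nat)) (W : nat).
Local Notation n := (size L).
Local Notation U := (n + size (flatten L)).
Local Notation E x y := (y \in row L x).
Hypothesis n_gt0 : 0 < n.
Hypothesis hW : 7 * U <= W.
Hypothesis row_lt : forall x w, x < n -> E x w -> w < n.
Hypothesis row_sym : forall x y, x < n -> y < n -> E x y = E y x.
Hypothesis row_uniq : forall x, x < n -> uniq (row L x).
Hypothesis row_conn : forall (S : pred nat) r, r < n -> S r ->
  (forall x w, x < n -> E x w -> S x -> S w) -> forall x, x < n -> S x.

(** Budgets are literal multiples of U: a phase taking j units hands k - j units on to the rest. *)
Lemma ok_seq_units j k p q s Q : j <= k ->
  ok W p s (j * U) (fun s1 => ok W q s1 ((k - j) * U) Q) -> ok W (Seq p q) s (k * U) Q.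
Proof. by move=> hjk h; rewrite -(subnKC hjk) mulnDl; apply: ok_seq. Qed.

Lemma ok_if_units b k p q s Q : 0 < k ->
  (eval_test b s -> ok W p s (k.-1 * U) Q) -> (~~ eval_test b s -> ok W q s (k.-1 * U) Q) ->
  ok W (If b p q) s (k * U) Q.
Proof.
by case: k => // k _ h1 h2; apply: ok_weaken (ok_if h1 h2) _ (fun _ h => h); lia.
Qed.

Lemma wp_ok_units k p s Q : bounded W s -> wp W p Q s -> cost p <= k -> ok W p s (k * U) Q.
Proof.
move=> bs h hk; apply: ok_weaken (wp_ok (word_ge6 n_gt0 hW) bs h) _ (fun _ h => h).
by apply: leq_trans hk _; apply: leq_pmulr; lia.
Qed.

Definition result s :=
  [\/ [/\ reg s 0 = 0, reg s 1 < n & within2 L (reg s 1)]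
    | reg s 0 = 1 /\ induced_P5 L (reg s 1) (reg s 2) (reg s 3) (reg s 4) (reg s 5)].

Definition view M lv pr s :=
  [/\ ready L W s, ram s = M, reg s rLev = lv & reg s rPar = pr].

Definition kept p s s' := forall r, ~~ assigned r p -> reg s' r = reg s r.

Lemma view_ok M lv pr p s T Q :
  all (fun r => ~~ assigned r p) [:: rN; rOne; rZero; rLev; rPar] -> ~~ writes p ->
  view M lv pr s -> ok W p s T Q ->
  ok W p s T (fun s' => [/\ Q s', view M lv pr s' & kept p s s']).
Proof.
move=> /allP na nw [rs sm sL sP] h; have [bs _ _ _ _] := rs.
apply: ok_weaken (ok_frame bs h) _ _ => // s' [hQ bs' hr hm]; split=> //.
rewrite /view hm // !hr ?na //; split=> //.
apply: ready_mono rs bs' _ _ => [q hq|a _]; last by rewrite hm.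
by apply: hr; apply: na; move: hq; rewrite !inE => /or3P[] ->; rewrite ?orbT.
Qed.

Lemma report1_ok M lv pr k a s : 1 < k -> 5 < a -> view M lv pr s -> reg s a < n ->
  within2 L (reg s a) -> ok W (report1 a) s (k * U) result.
Proof.
move=> hk ha [[bs _ _ s0 _] _ _ _] hn h2; apply: wp_ok_units => //=.
rewrite /upd /= ifN ?s0 ?addn0; last by lia.
by do 2!split=> //; [apply: bs.1 | left; rewrite /= /upd].
Qed.

Lemma report5_ok M lv pr k a b c d e s : 5 < k ->
  [&& 5 < a, 5 < b, 5 < c, 5 < d & 5 < e] -> view M lv pr s ->
  induced_P5 L (reg s a) (reg s b) (reg s c) (reg s d) (reg s e) ->
  ok W (report5 a b c d e) s (k * U) result.
Proof.
move=> hk /and5P[ha hb hc hd he] [[bs _ _ s0 _] _ _ _] h5; apply: wp_ok_units => //=.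
have hne x i : 5 < x -> i < 6 -> (x == i) = false by lia.
rewrite /upd /= !hne // s0 !addn0.
split=> //; do 5!(split; first by apply: bs.1).
by right; rewrite /= /upd.
Qed.

Lemma parent_ok M lv pr dst src s : view M lv pr s -> pr + n <= W -> reg s src < n ->
  ok W (parent dst src) s (2 * U) (fun s' => reg s' dst = M (pr + reg s src)).
Proof.
move=> [[bs _ _ _ _] sm _ sP] hpr hn; apply: wp_ok_units => //=.
by rewrite /upd /= sP eqxx sm; split=> //; lia.
Qed.

Lemma copy_ok M lv pr dst src s : view M lv pr s ->
  ok W (Add dst src rZero) s (1 * U) (fun s' => reg s' dst = reg s src).
Proof.
move=> [[bs _ _ s0 _] _ _ _]; apply: wp_ok_units => //=.
by rewrite /upd eqxx s0 addn0; split=> //; apply: bs.1.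
Qed.

Section View.
Variables (M : nat -> nat) (lv pr : nat).
Hypothesis a1 : input_end L <= lv.
Hypothesis a2 : lv + n <= pr.
Hypothesis a3 : pr + n <= W.
Let lev x := M (lv + x).
Let par x := M (pr + x).

Lemma select_view k rl p q s : k < 6 -> q != rP -> view M lv pr s ->
  ok W (select k rl p q) s (39 * U) (fun s' =>
    [/\ best_below (candidate L lev k rl (reg s p) (reg s q)) (score L lev k) n
      (reg s' rBest) (reg s' rR), view M lv pr s' & kept (select k rl p q) s s']).
Proof.
move=> hk hq vs; have [rs sm sL sP] := vs; apply: view_ok => //.
have ar : arrays L W s by rewrite /arrays sL sP.
apply: ok_weaken (select_ok n_gt0 hW row_lt rl p hk hq rs ar) _ _ => // s' [_].
by rewrite /lev_of sL sm.
Qed.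

Lemma adjacent_view p q s : p \notin rAdj :: loop_regs -> q \notin rAdj :: loop_regs ->
  view M lv pr s -> reg s p < n ->
  ok W (adjacent p q) s (15 * U) (fun s' =>
    [/\ reg s' rAdj = E (reg s p) (reg s q), view M lv pr s' & kept (adjacent p q) s s']).
Proof.
move=> hp hq vs hn; have [rs sm sL sP] := vs; apply: view_ok => //.
by apply: ok_weaken (adjacent_ok n_gt0 hW hp hq rs hn) _ _ => // s' [].
Qed.

Section Center.
Variables (y u w : nat) (lev2 par2 : nat -> nat).
Hypothesis fv : far_vertex L 0 y u w lev par lev2 par2.

Lemma near_ok s : view M lv pr s -> reg s rU = u -> reg s rW = w -> lev w = 3 ->
  ok W near_prog s (47 * U) result.
Proof.
move=> vs sU sW w_lev; have w_lt := fv_w_lt fv.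
have wp_lt : par w < n.
  by have [|] := tree_edge row_sym (fv_tree1 fv) w_lt; first by rewrite w_lev.
apply: (@ok_seq_units 2) => //.
apply: ok_weaken (view_ok _ _ vs (parent_ok rD vs a3 _)) _ _ => //; first by rewrite sW.
rewrite sW -/(par w) => s1 [s1D v1 f1].
apply: (@ok_seq_units 39) => //.
apply: ok_weaken (select_view false rU _ _ v1) _ _ => // s2.
rewrite s1D f1 // sU => -[[b1 b2] v2 f2].
(* A candidate exists, so rBest is positive and rR holds a genuine one. *)
have [|R_lt Rc _] := b2.
  have [z hz Cz] := near_candidate row_lt row_sym row_uniq fv w_lev.
  by apply: leq_ltn_trans (b1 z hz Cz).
have [[_ _ _ s20 _] _ _ _] := v2.
apply: (report5_ok _ _ v2) => //.
rewrite s20 (f2 rU) // (f2 rD) // (f2 rW) // s1D !f1 // sU sW; exact: (near_P5 row_sym fv w_lev R_lt Rc).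
Qed.

Lemma far_ok s : view M lv pr s -> reg s rU = u -> reg s rW = w -> reg s rY = y ->
  lev w = 4 -> ok W far_prog s (150 * U) result.
Proof.
move=> vs sU sW sY w_lev; have w_lt := fv_w_lt fv; have y_lt := fv_y_lt fv; have u_lt := fv_u_lt fv.
have [a_lt u2_lt _ _] := far_parents row_sym fv w_lev.
apply: (@ok_seq_units 2) => //.
apply: ok_weaken (view_ok _ _ vs (parent_ok rB vs a3 _)) _ _ => //; first by rewrite sW.
rewrite sW -/(par w) => s1 [s1B v1 f1].
apply: (@ok_seq_units 39) => //.
apply: ok_weaken (select_view false rY _ _ v1) _ _ => // s2.
rewrite s1B f1 // sY => -[[b1 b2] v2 f2].
have [|c_lt Rc _] := b2.
  have [z hz Cz] := far_candidate row_lt row_sym row_uniq fv w_lev.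
  by apply: leq_ltn_trans (b1 z hz Cz).
have := far_P5 row_sym fv w_lev c_lt Rc; set c := reg s2 rR in c_lt Rc *.
(* [H5] has the same nested conditionals as the program; each test outcome strips one of them, until
   it states the path to be reported. *)
move=> H5; apply: (@ok_seq_units 1) => //.
apply: ok_weaken (view_ok _ _ v2 (copy_ok rC rR v2)) _ _ => // s3 [s3C v3 f3].
have s3B : reg s3 rB = par w by rewrite f3 // f2.
have s3W : reg s3 rW = w by rewrite f3 // f2 // f1.
have s3U : reg s3 rU = u by rewrite f3 // f2 // f1.
have s3Y : reg s3 rY = y by rewrite f3 // f2 // f1.
apply: (@ok_seq_units 15) => //.
apply: ok_weaken (adjacent_view (p := rC) (q := rW) _ _ v3 _) _ _ => //; first by rewrite s3C.
rewrite s3C s3W => s4 [s4A v4 f4].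
have [[_ _ s41 s40 _] _ _ _] := v4.
apply: ok_if_units => //=; rewrite s4A s41 eqb1 => e; rewrite ?e ?(negbTE e) in H5.
  apply: (report5_ok _ _ v4) => //.
  by rewrite s40 !f4 // s3U s3Y s3C s3W.
apply: (@ok_seq_units 15) => //.
apply: ok_weaken (adjacent_view (p := rY) (q := rB) _ _ v4 _) _ _ => //; first by rewrite f4 // s3Y.
rewrite !f4 // s3Y s3B => s5 [s5A v5 f5].
have [[_ _ s51 s50 _] _ _ _] := v5.
apply: ok_if_units => //=; rewrite s5A s51 eqb1 => e1; rewrite ?e1 ?(negbTE e1) in H5.
  apply: (report5_ok _ _ v5) => //.
  by rewrite s50 !f5 // !f4 // s3U s3Y s3B s3W.
have s5B : reg s5 rB = par w by rewrite f5 // f4.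
apply: (@ok_seq_units 2) => //.
apply: ok_weaken (view_ok _ _ v5 (parent_ok rD v5 a3 _)) _ _ => //; first by rewrite s5B.
rewrite s5B -/(par (par w)) => s6 [s6D v6 f6].
have s6B : reg s6 rB = par w by rewrite f6.
have s6C : reg s6 rC = c by rewrite f6 // f5 // f4.
have s6Y : reg s6 rY = y by rewrite f6 // f5 // f4.
have s6U : reg s6 rU = u by rewrite f6 // f5 // f4.
have s6W : reg s6 rW = w by rewrite f6 // f5 // f4.
apply: (@ok_seq_units 15) => //.
apply: ok_weaken (adjacent_view (p := rD) (q := rY) _ _ v6 _) _ _ => //; first by rewrite s6D.
rewrite s6D s6Y => s7 [s7A v7 f7].
have [[_ _ s71 s70 _] _ _ _] := v7.
apply: ok_if_units => //=; rewrite s7A s71 eqb1 => e2; rewrite ?e2 ?(negbTE e2) in H5.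
  apply: (report5_ok _ _ v7) => //.
  by rewrite !f7 // s6C s6Y s6D s6B s6W.
apply: (@ok_seq_units 15) => //.
apply: ok_weaken (adjacent_view (p := rU) (q := rD) _ _ v7 _) _ _ => //; first by rewrite f7 // s6U.
rewrite !f7 // s6D s6U => s8 [s8A v8 f8].
have [[_ _ s81 s80 _] _ _ _] := v8.
apply: ok_if_units => //=; rewrite s8A s81 eqb1 => e3; rewrite ?e3 ?(negbTE e3) in H5.
  apply: (report5_ok _ _ v8) => //.
  by rewrite !f8 // !f7 // s6C s6Y s6D s6B s6U.
apply: (report5_ok _ _ v8) => //.
by rewrite s80 !f8 // !f7 // s6Y s6D s6B s6U.
Qed.

End Center.
End View.

(** The second search alters the memory, though not on the first two arrays, so facts about the
    first search are carried over pointwise. *)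
Lemma bfs_tree_ext r lev par lev' par' : r < n ->
  (forall x, x < n -> lev' x = lev x) -> (forall x, x < n -> par' x = par x) ->
  bfs_tree L 5 r lev par -> bfs_tree L 5 r lev' par'.
Proof.
move=> hr El Ep [h1 h2 h3 h4 h5]; split.
- by rewrite El.
- by move=> x hx; rewrite El //; apply: h2.
- by move=> x hx; rewrite El //; apply: h3.
- by move=> x hx; rewrite El // Ep // => /(h4 _ hx)[hp ? ?]; rewrite El.
- by move=> x w hx hw; rewrite !El ?(row_lt hx hw) //; apply: h5.
Qed.

Lemma score_ext lev lev' k x : x < n -> (forall x, x < n -> lev' x = lev x) ->
  score L lev' k x = score L lev k x.
Proof. by move=> hx El; apply: eq_in_count => w hw; rewrite El // (row_lt hx hw). Qed.

(** The number n is no label, so no row contains it. *)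
Lemma candidate_free lev k p x : x < n -> candidate L lev k true p n x = (lev x == k).
Proof.
move=> hx; rewrite /candidate /=; suff -> : n \notin row L x by rewrite andbT.
by apply/negP => /(row_lt hx); rewrite ltnn.
Qed.

Lemma candidate_adjacent lev k p x : p < n -> x < n ->
  candidate L lev k false p n x = (lev x == k) && E x p.
Proof.
by move=> hp hx; rewrite -(candidate_free lev k p hx) /candidate /= -andbA [X in _ && X]andbC.
Qed.

(** [M0] says that the memory behind the first two arrays is still blank, as the level array of the
    second search has to be. *)
Lemma center_ok M lv pr y u s :
  let lev x := M (lv + x) in let par x := M (pr + x) in
  input_end L <= lv -> pr = lv + n -> pr + n + n + n <= W ->
  (forall a, pr + n <= a -> M a = 0) ->
  view M lv pr s -> reg s rY = y -> reg s rU = u ->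
  bfs_tree L 5 0 lev par -> (forall x, x < n -> lev x != 5) ->
  y < n -> lev y = 3 ->
  (forall a, a < n -> lev a = 3 -> score L lev 3 a <= score L lev 3 y) ->
  u < n -> lev u = 2 -> E u y ->
  (forall a, a < n -> lev a = 2 -> E a y -> score L lev 2 a <= score L lev 2 u) ->
  ok W center_prog s (300 * U) result.
Proof.
move=> lev par a1 epr a3 M0 vs sY sU tree1 no5 y_lt y_lev y_max u_lt u_lev uy u_max.
have [rs sm sL sP] := vs; have [bs sN s1 s0 inp] := rs.
pose lv2 := pr + n; pose pr2 := lv2 + n.
have elv2 : lv2 = pr + n by []; have epr2 : pr2 = lv2 + n by [].
have c1 : input_end L <= lv2 by lia.
have c2 : lv2 + n <= pr2 by lia.
have c3 : pr2 + n <= W by lia.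
have pre : wp W (Seq (Add rLev rPar rN) (Add rPar rLev rN)) (fun t =>
    [/\ reg t rLev = lv2, reg t rPar = pr2 & ram t = M]) s.
  by rewrite /= /upd /= sP sN; split; [lia | split; [lia | ]].
apply: (@ok_seq_units 2) => //.
apply: ok_weaken (ok_frame bs (wp_ok_units bs pre (leqnn 2))) _ _ => // t1.
case=> -[t1L t1P t1m] bt1 f1 _.
have rt1 : ready L W t1 by apply: ready_mono rs bt1 _ _ => [q|a _]; [rewrite !inE => /or3P[] /eqP->; apply: f1 | rewrite t1m sm].
have t1Y : reg t1 rY = y by rewrite f1.
have t1U : reg t1 rU = u by rewrite f1.
have ar1 : arrays L W t1 by rewrite /arrays t1L t1P; split; lia.
apply: (@ok_seq_units 94) => //.
apply: ok_weaken (ok_frame bt1 (bfs_ok n_gt0 hW row_lt u_lt rt1 ar1 t1U _)) _ _ => //.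
  by move=> x _; rewrite /lev_of t1L t1m M0 //; lia.
move=> t2 [[tree2 so] bt2 f2 _].
have low a : a < lv2 -> ram t2 a = M a by move=> ha; rewrite so ?t1m // t1L ha.
have v2 : view (ram t2) lv2 pr2 t2.
  split=> //; rewrite ?f2 //; apply: ready_mono rt1 bt2 _ _ => [q|a ha].
    by rewrite !inE => /or3P[] /eqP->; apply: f2.
  by rewrite low ?t1m //; lia.
have t2Y : reg t2 rY = y by rewrite f2.
have t2U : reg t2 rU = u by rewrite f2.
set M2 := ram t2 in low v2.
have [[_ t2N _ t20 _] _ t2L t2P] := v2.
rewrite /lev_of /par_of t2L t2P -/M2 in tree2.
apply: (@ok_seq_units 39) => //.
apply: ok_weaken (select_view c1 c2 c3 true rZero _ _ v2) _ _ => //.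
rewrite t2N t20 => t3 [[b1 b2] v3 f3].
have [[_ t3N _ t30 _] _ t3L t3P] := v3.
apply: ok_if_units => //= hb; rewrite t30 in hb.
  apply: (report1_ok _ _ v3); rewrite // f3 // t2U //.
  apply: (tree_within2 row_lt row_sym row_conn tree2 u_lt) => x hx.
  apply/negP => hx4; have := b1 x hx; rewrite candidate_free // => /(_ hx4).
  by rewrite (eqP hb).
have [|w_lt] := b2; first by rewrite lt0n.
rewrite candidate_free // => /eqP w_lev2 _.
set w := reg t3 rR in w_lt w_lev2.
have [bt3 _ _ _ _] : ready L W t3 by case: v3.
have m3 : ram t3 = M2 by case: v3.
set code := Seq (Add rW _ _) _.
have post : wp W code (fun t => [/\ reg t rW = w, reg t rT2 = M2 (lv + w), reg t rT3 = 3,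
   reg t rLev = lv & reg t rPar = pr /\ ram t = M2]) t3.
  rewrite /= /upd /= t30 t3L t3N -/w addn0 m3.
  have -> : lv2 - n = pr by rewrite addnK.
  have -> : pr - n = lv by rewrite epr addnK.
  by split; [apply: bt3.1 | split; [lia | ]].
apply: (@ok_seq_units 6) => //.
apply: ok_weaken (ok_frame bt3 (wp_ok_units bt3 post (leqnn 6))) _ _ => // t4.
case=> -[t4W t4T2 t4T3 t4L [t4P t4m]] bt4 f4 _.
have v4 : view M2 lv pr t4.
  split=> //; apply: ready_mono (bt4) _ _ => [|q|a _]; last by rewrite t4m -m3.
    by case: v3.
  by rewrite !inE => /or3P[] /eqP->; apply: f4.
have El x : x < n -> M2 (lv + x) = lev x by move=> hx; rewrite low //; lia.
have Ep x : x < n -> M2 (pr + x) = par x by move=> hx; rewrite low //; lia.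
have fv : far_vertex L 0 y u w (fun x => M2 (lv + x)) (fun x => M2 (pr + x))
    (fun x => M2 (lv2 + x)) (fun x => M2 (pr2 + x)).
  split=> //; rewrite ?El //.
  - exact: bfs_tree_ext El Ep tree1.
  - by move=> x hx; rewrite El ?no5.
  - by move=> a ha; rewrite !(score_ext _ _ El) // El //; apply: y_max.
  - by move=> a ha; rewrite !(score_ext _ _ El) // El //; apply: u_max.
have t4U : reg t4 rU = u by rewrite f4 // f3.
have t4Y : reg t4 rY = y by rewrite f4 // f3.
have b3 : pr + n <= W by lia.
have b0 : lv + n <= pr by lia.
apply: ok_if_units => //=; rewrite t4T2 t4T3 => e.
  by apply: ok_weaken (near_ok a1 b0 b3 fv v4 t4U t4W (eqP e)) _ _ => //; lia.
have [e3|e4] := far_level row_lt row_sym row_conn fv; first by rewrite e3 in e.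
by apply: ok_weaken (far_ok a1 b0 b3 fv v4 t4U t4W t4Y e4) _ _ => //; lia.
Qed.

(** Every input word is the number n, an address or a label; this makes the initial state
    bounded. *)
Lemma encode_le a : nth 0 (encode L) a <= input_end L.
Proof.
have [ha|ha] := ltnP a (size (encode L)); last by rewrite nth_default.
have eE := input_endE L.
have: nth 0 (encode L) a \in encode L by apply: mem_nth.
rewrite /encode inE mem_cat => /or3P[/eqP->|/mapP[i _ ->]|]; first by lia.
  exact: row_start_le.
case/flattenP=> l hl hm; have hi : index l L < n by rewrite index_mem.
by have := row_lt hi; rewrite /row nth_index // => /(_ _ hm); lia.
Qed.

Lemma size_encode : size (encode L) = input_end L.
Proof. by rewrite input_endE /encode /= size_cat size_map size_iota; lia. Qed.

(** On the longest branch the phases use 5 units of setup, 94 for the search, 4 times 39 for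
    selections, 4 for tests and copies, and 300 for [center_prog]: 559 in all. *)
Lemma main_ok : ok W main_prog (initial_state (encode L)) (600 * U) result.
Proof.
set s := initial_state _; have eE := input_endE L.
have bs : bounded W s.
  by split=> a //=; apply: leq_trans (encode_le _) _; lia.
pose lv := input_end L; pose pr := lv + n.
have elv : lv = input_end L by []; have epr : pr = lv + n by [].
rewrite /main_prog; set code := Seq (Const rOne 1) _.
have pre : wp W code (fun t => [/\ [/\ reg t rOne = 1, reg t rN = n & reg t rZero = 0],
    reg t rLev = lv, reg t rPar = pr & ram t = nth 0 (encode L)]) s.
  rewrite /code /s /initial_state.
  have e0 : nth 0 (encode L) 0 = n by [].
  move: (encode L) e0 (nth_encode_start (leqnn n)) => l e0 e1.
  by rewrite /= /upd /= e0 addn1 e1 -/(input_end L); do !split=> //; lia.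
apply: (@ok_seq_units 5) => //.
apply: ok_weaken (ok_frame bs (wp_ok_units bs pre (leqnn 5))) _ _ => // t1.
case=> -[[t1One t1N t10] t1L t1P t1m] bt1 _ _.
have rt1 : ready L W t1 by split=> // a _; rewrite t1m.
have b2 : lv + n <= pr by lia.
have b3 : pr + n <= W by lia.
have ar1 : arrays L W t1 by rewrite /arrays t1L t1P; split.
apply: (@ok_seq_units 94) => //.
apply: ok_weaken (ok_frame bt1 (bfs_ok n_gt0 hW row_lt n_gt0 rt1 ar1 t10 _)) _ _ => //.
  by move=> x _; rewrite /lev_of t1L t1m nth_default // size_encode; lia.
move=> t2 [[tree so] bt2 f2 _].
have v2 : view (ram t2) lv pr t2.
  split=> //; rewrite ?f2 //; apply: ready_mono rt1 bt2 _ _ => [q|a ha].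
    by rewrite !inE => /or3P[] /eqP->; apply: f2.
  by rewrite so // t1L ha.
have M0 a : pr + n <= a -> ram t2 a = 0.
  by move=> ha; rewrite so ?t1P ?ha ?orbT // t1m nth_default // size_encode; lia.
have [[_ t2N _ t20 _] _ t2L t2P] := v2.
rewrite /lev_of /par_of t2L t2P in tree; set M := ram t2 in tree v2 M0.
pose lev x := M (lv + x); pose par x := M (pr + x).
rewrite -/lev -/par in tree.
have sel := @select_view M lv pr (leqnn _) b2 b3.
have none k p b r : best_below (candidate L lev k true p n) (score L lev k) n b r ->
    b == 0 -> forall x, x < n -> lev x != k.
  move=> [h _] /eqP b0 x hx; apply/negP => hk.
  by have := h x hx; rewrite candidate_free // b0 => /(_ hk).
apply: (@ok_seq_units 39) => //.
apply: ok_weaken (sel 5 true rZero rN _ _ _ v2) _ _ => //.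
rewrite t2N => t3 [best3 v3 f3].
have [[_ t3N _ t30 _] _ _ _] := v3.
apply: ok_if_units => //=; rewrite t30 => hb3; last first.
  have [_ [|x_lt]] := best3; first by rewrite lt0n.
  rewrite candidate_free //; set x := reg t3 rR => /eqP lx0 _; have lx : lev x = 5 := lx0.
  have [|p1_lt _ _ l1] := tree_edge row_sym tree x_lt; first by rewrite lx.
  have [|p2_lt _ _ l2] := tree_edge row_sym tree p1_lt; first by rewrite -ltnS -l1 lx.
  apply: (@ok_seq_units 2) => //.
  apply: ok_weaken (view_ok _ _ v3 (parent_ok rY v3 b3 _)) _ _ => //.
  rewrite -/x -/(par x) => t4 [t4Y v4 f4].
  apply: (@ok_seq_units 2) => //.
  apply: ok_weaken (view_ok _ _ v4 (parent_ok rU v4 b3 _)) _ _ => //; first by rewrite t4Y.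
  rewrite t4Y -/(par (par x)) => t5 [t5U v5 f5].
  apply: (@ok_seq_units 2) => //.
  apply: ok_weaken (view_ok _ _ v5 (parent_ok rW v5 b3 _)) _ _ => //; first by rewrite t5U.
  rewrite t5U -/(par (par (par x))) => t6 [t6W v6 f6].
  have [[_ _ _ t60 _] _ _ _] := v6.
  apply: (report5_ok _ _ v6) => //.
  rewrite t60 t6W (f6 rU) // t5U (f6 rY) // f5 // t4Y (f6 rR) // f5 // f4 //.
  exact: (tree_deep_P5 row_sym tree n_gt0 x_lt lx).
have no5 := none _ _ _ _ best3 hb3.
apply: (@ok_seq_units 39) => //.
apply: ok_weaken (sel 4 true rZero rN _ _ _ v3) _ _ => //.
rewrite t3N => t4 [best4 v4 f4].
have [[_ t4N _ t40 _] _ _ _] := v4.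
apply: ok_if_units => //=; rewrite t40 => hb4.
  apply: (report1_ok _ _ v4); rewrite // t40 //.
  exact: (tree_within2 row_lt row_sym row_conn tree n_gt0 (none _ _ _ _ best4 hb4)).
(* The parent of a vertex of level 4 shows that level 3 is inhabited, so that y exists. *)
have [x3 x3_lt lx3] : exists2 x, x < n & lev x = 3.
  have [_ [|x_lt]] := best4; first by rewrite lt0n.
  rewrite candidate_free // => /eqP lx0 _; have lx : lev (reg t4 rR) = 4 := lx0.
  have [|p_lt _ _ l1] := tree_edge row_sym tree x_lt; first by rewrite lx.
  by exists (par (reg t4 rR)) => //; apply: succn_inj; rewrite -l1 lx.
apply: (@ok_seq_units 39) => //.
apply: ok_weaken (sel 3 true rZero rN _ _ _ v4) _ _ => //.
rewrite t4N => t5 [[best5 ex5] v5 f5].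
have [|y_lt] := ex5.
  by apply: leq_ltn_trans (best5 x3 x3_lt _) => //; rewrite candidate_free //; apply/eqP.
set y := reg t5 rR in y_lt *; rewrite candidate_free // => /eqP y_lev0 by5; have y_lev : lev y = 3 := y_lev0.
have y_max a : a < n -> lev a = 3 -> score L lev 3 a <= score L lev 3 y.
  by move=> ha la; rewrite -ltnS by5; apply: best5 => //; rewrite candidate_free //; apply/eqP.
apply: (@ok_seq_units 1) => //.
apply: ok_weaken (view_ok _ _ v5 (copy_ok rY rR v5)) _ _ => // t6 [t6Y v6 f6].
have [[_ t6N _ t60 _] _ _ _] := v6.
have [x2 [x2_lt lx2 x2y]] : exists x, [/\ x < n, lev x = 2 & E x y].
  have [|p_lt e1 _ l1] := tree_edge row_sym tree y_lt; first by rewrite y_lev.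
  by exists (par y); split=> //; apply: succn_inj; rewrite -l1 y_lev.
apply: (@ok_seq_units 39) => //.
apply: ok_weaken (sel 2 false rY rN _ _ _ v6) _ _ => //.
rewrite t6N t6Y -/y => t7 [[best7 ex7] v7 f7].
have [|u_lt] := ex7.
  by apply: leq_ltn_trans (best7 x2 x2_lt _) => //; rewrite candidate_adjacent // x2y andbT; apply/eqP.
set u := reg t7 rR in u_lt *; rewrite candidate_adjacent // => /andP[/eqP u_lev0 uy] bu7; have u_lev : lev u = 2 := u_lev0.
have u_max a : a < n -> lev a = 2 -> E a y -> score L lev 2 a <= score L lev 2 u.
  by move=> ha la ay; rewrite -ltnS bu7; apply: best7 => //; rewrite candidate_adjacent // ay andbT; apply/eqP.
apply: (@ok_seq_units 1) => //.
apply: ok_weaken (view_ok _ _ v7 (copy_ok rU rR v7)) _ _ => // t8 [t8U v8 f8].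
have t8Y : reg t8 rY = y by rewrite f8 // f7.
have b4 : pr + n + n + n <= W by lia.
apply: ok_weaken (center_ok (leqnn _) epr b4 M0 v8 t8Y t8U tree no5 y_lt y_lev y_max u_lt u_lev uy u_max) _ _ => //.
by rewrite leq_mul2r; apply/orP; right.
Qed.

End Main.

(** * From labels to vertices *)

(** For k at least [#|G|] the bound is just the cap of the search in [dist]. *)
Lemma walk_dist_le (G : sgraph) (x y : G) k : walk_of_length x y k -> dist x y <= k.
Proof.
move=> hw; rewrite /dist; have [hk|hk] := ltnP k #|G|; last first.
  by apply: leq_trans (find_size _ _) _; rewrite size_iota.
rewrite leqNgt; apply/negP => /(before_find 0).
by rewrite nth_iota // add0n hw.
Qed.

(** Handshake inequality, by injecting the arcs into pairs of an edge and a bit. *)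
Lemma sum_degree_le (G : sgraph) :
  \sum_(v : G) #|[set w | adj v w]| <= 2 * #|edges G|.
Proof.
pose arcs := [set p : G * G | adj p.1 p.2].
have -> : \sum_(v : G) #|[set w | adj v w]| = #|arcs|.
  rewrite -sum1_card (eq_bigl (fun p : G * G => adj p.1 p.2)); last by move=> p; rewrite inE.
  rewrite -(pair_big_dep xpredT (fun v w : G => adj v w) (fun _ _ => 1)) /=.
  by apply: eq_bigr => v _; rewrite -sum1_card; apply: eq_bigl => w; rewrite inE.
(* An arc is determined by its edge and its orientation. *)
pose f (p : G * G) := ([set p.1; p.2], enum_rank p.1 < enum_rank p.2).
have finj : {in arcs &, injective f}.
  move=> [a b] [c d]; rewrite !inE /f /= => hab hcd [eS eR].
  have /set2P[] : a \in [set c; d] by rewrite -eS set21.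
    move=> eac; have /set2P[] : b \in [set c; d] by rewrite -eS set22.
      by move=> ebc; rewrite eac ebc adj_irrefl in hab.
    by move=> ->; rewrite eac.
  move=> ead; have /set2P[ebc|ebd] : b \in [set c; d] by rewrite -eS set22.
    rewrite ead ebc in hab eR *; move: eR; case: ltngtP => // /ord_inj/enum_rank_inj.
    by move=> e; rewrite e adj_irrefl in hab.
  by rewrite ead ebd adj_irrefl in hab.
rewrite -(card_in_imset finj) mulnC -card_bool -cardsT -cardsX.
apply: subset_leq_card; apply/subsetP => _ /imsetP[[a b] hab ->].
rewrite !inE /= andbT; rewrite inE /= in hab.
by apply/existsP; exists a; apply/existsP; exists b; rewrite hab /=.
Qed.

(** * Adjacency lists of a connected graph and the return to its vertices *)

Section Transfer.
Variables (G : sgraph) (lab : G -> nat) (L : seq (seq nat)).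
Hypothesis conn : connected G.
Hypothesis labL : labelling lab.
Hypothesis adjL : adjacency_lists lab L.
Local Notation n := (size L).
Local Notation E x y := (y \in row L x).

Lemma size_lists : n = #|G|. Proof. by case: adjL. Qed.

Lemma lists_gt0 : 0 < n. Proof. by rewrite size_lists; case: conn. Qed.

Lemma lab_onto x : x < n -> exists v, lab v = x.
Proof.
rewrite size_lists => hx; have [inj lt] := labL.
pose f v := Ordinal (lt v).
have finj : injective f by move=> v w [] /inj.
have : Ordinal hx \in codom f by apply: inj_card_onto => //; rewrite card_ord.
by case/codomP=> v [->]; exists v.
Qed.

Lemma lab_lt v : lab v < n. Proof. by rewrite size_lists; case: labL. Qed.

Lemma edge_lab v w : E (lab v) (lab w) = adj v w.
Proof.
have [inj _] := labL; have [_ /(_ v)/perm_mem ->] := adjL.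
by rewrite mem_map // mem_filter mem_enum andbT.
Qed.

Lemma lists_lt x w : x < n -> E x w -> w < n.
Proof.
case/lab_onto=> v <-; have [_ /(_ v)/perm_mem ->] := adjL.
by case/mapP=> z _ ->; apply: lab_lt.
Qed.

Lemma lists_sym x y : x < n -> y < n -> E x y = E y x.
Proof. by case/lab_onto=> v <- /lab_onto[w <-]; rewrite !edge_lab adj_sym. Qed.

Lemma lists_uniq x : x < n -> uniq (row L x).
Proof.
case/lab_onto=> v <-; have [_ /(_ v)/perm_uniq ->] := adjL; have [inj _] := labL.
by rewrite map_inj_uniq // filter_uniq // enum_uniq.
Qed.

Lemma lists_conn (S : pred nat) r : r < n -> S r ->
  (forall x w, x < n -> E x w -> S x -> S w) -> forall x, x < n -> S x.
Proof.
case/lab_onto=> v <- Sv hS x /lab_onto[w <-].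
have [_ /(_ v w)/connectP[p hp ->]] := conn.
elim: p v Sv hp => [|z p IH] v Sv //= /andP[hz hp].
by apply: IH => //; apply: hS (lab_lt v) _ Sv; rewrite edge_lab.
Qed.

Lemma size_arcs_le : size (flatten L) <= 2 * #|edges G|.
Proof.
apply: leq_trans (sum_degree_le G).
have [inj lt] := labL; have [sz per] := adjL.
pose f v := Ordinal (lt v).
have finj : injective f by move=> v w [] /inj.
have fbij : bijective f by apply: inj_card_bij => //; rewrite card_ord.
rewrite -sum_row_size sz big_mkord (reindex f) /=; last exact: onW_bij.
apply: leq_sum => v _; rewrite (perm_size (per v)) size_map.
rewrite cardE; apply: uniq_leq_size => [|w]; first by rewrite filter_uniq // enum_uniq.
by rewrite mem_filter => /andP[hw _]; rewrite mem_enum inE.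
Qed.

Lemma within2_principal v : within2 L (lab v) -> principal v.
Proof.
move=> h; apply/bigmax_leqP => w _.
have wit k (p : k.-tuple G) : path (@adj G) v p -> last v p = w -> k <= 2 -> dist v w <= 2.
  move=> hp hl hk; apply: leq_trans hk; apply: walk_dist_le.
  by apply/existsP; exists p; rewrite hp hl eqxx.
have [inj _] := labL.
case: (h (lab w) (lab_lt w)) => [/inj e|e|[m /lab_onto[z <-]]].
- exact: (wit 0 [tuple]).
- by rewrite edge_lab in e; apply: (wit 1 [tuple w]); rewrite //= e.
- by rewrite !edge_lab => /andP[e1 e2]; apply: (wit 2 [tuple z; w]); rewrite //= e1 e2.
Qed.

Lemma induced_P5_embedding a b c d e : induced_P5 L a b c d e ->
  exists f : path_graph 5 -> G, induced_embedding f /\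
    forall i : 'I_5, nth 0 [:: a; b; c; d; e] i = lab (f i).
Proof.
case/and3P=> /and5P[/lab_onto[va <-] /lab_onto[vb <-] /lab_onto[vc <-] /lab_onto[vd <-]
  /lab_onto[ve <-]]; rewrite !edge_lab.
case/and4P=> e1 e2 e3 e4 /and5P[n1 n2 n3 n4 /andP[n5 n6]].
pose f (i : path_graph 5) := nth va [:: va; vb; vc; vd; ve] i.
exists f; split; last by case=> [[|[|[|[|[|]]]]]].
have fadj i j : adj (f i) (f j) = adj i j.
  suff H (k l : 'I_5) : k <= l -> adj (f k) (f l) = @path_adj 5 k l.
    have [/H//|/ltnW/H hij] := leqP (i : 'I_5) (j : 'I_5).
    by rewrite adj_sym hij /= path_adj_sym.
  by case: k l => [[|[|[|[|[|]]]]] hk] // [[|[|[|[|[|]]]]] hl] //= _;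
    rewrite /f /path_adj /= ?adj_irrefl ?e1 ?e2 ?e3 ?e4 // ; apply/negbTE.
split=> // i j fij.
(* No two vertices of the path have the same neighbours, so preserving adjacency both ways already
   forces injectivity. *)
have nb k : path_adj (i : 'I_5) k = path_adj (j : 'I_5) k.
  by have := fadj i k; rewrite fij fadj.
have := (nb (inord 0), nb (inord 1), nb (inord 2), nb (inord 3), nb (inord 4)).
rewrite /path_adj !inordK //; move: nb => _ {fij}.
case: i j => [[|[|[|[|[|]]]]] hi] // [[|[|[|[|[|]]]]] hj] //= h; try by apply: val_inj.
all: by case: h => [[[[]]]].
Qed.

(** The lists have at most two entries per edge, so U is at most twice the size of G and 600 units
    become 1200; the same bound leaves ample room for the word size. *)
Lemma main_prog_correct :
  exists t s, exec (1200 * (#|G| + #|edges G|)) main_prog (initial_state (encode L)) t s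
    /\ t <= 1200 * (#|G| + #|edges G|)
    /\ (reports_principal lab s \/ reports_induced_P5 lab s).
Proof.
have hn := size_lists; have ha := size_arcs_le.
have hU : n + size (flatten L) <= 2 * (#|G| + #|edges G|) by lia.
have hW : 7 * (n + size (flatten L)) <= 1200 * (#|G| + #|edges G|) by lia.
have [t [s [h [ht hr]]]] :=
  main_ok lists_gt0 hW lists_lt lists_sym lists_uniq lists_conn.
exists t, s; split=> //; split; first by lia.
case: hr => [[s0 /lab_onto[v ev] h2]|[s0 /induced_P5_embedding[f [hf ef]]]].
  by left; split=> //; exists v; rewrite ev; split=> //; apply: within2_principal; rewrite ev.
by right; split=> //; exists f; split=> // i; rewrite -ef; case: i => [[|[|[|[|[|]]]]]].
Qed.

End Transfer.

Theorem theorem15 :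
  (forall G : sgraph, connected G ->
     (exists v : G, principal v) \/ contains_induced (path_graph 5) G)
  /\
  (exists (p : prog) (c : nat),
     forall (G : sgraph) (lab : G -> nat) (L : seq (seq nat)),
       connected G -> labelling lab -> adjacency_lists lab L ->
       exists (t : nat) (s : state),
         exec (c * (#|G| + #|edges G|)) p (initial_state (encode L)) t s
         /\ t <= c * (#|G| + #|edges G|)
         /\ (reports_principal lab s \/ reports_induced_P5 lab s)).
Proof.
split; last first.
  by exists main_prog, 1200 => G lab L conn labL adjL; apply: main_prog_correct.
move=> G conn.
(* Since the program always reports one of the two outcomes, running it on any labelling proves
   existence; the enumeration of G supplies one. *)
pose lab (v : G) : nat := enum_rank v.
pose L := [seq [seq lab w | w <- enum G & adj v w] | v <- enum G].
have labL : labelling lab.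
  by split=> [v w /ord_inj/enum_rank_inj|v]; last exact: ltn_ord.
have adjL : adjacency_lists lab L.
  split=> [|v]; first by rewrite size_map -cardE.
  by rewrite (nth_map v) ?nth_enum_rank // -cardE ltn_ord.
have [t [s [_ [_ [[_ [v [_ hv]]]|[_ [f [hf _]]]]]]]] := main_prog_correct conn labL adjL.
  by left; exists v.
by right; exists f.
Qed.
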